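(* Let $a,b,c,d,e\in\mathbb{R}$ with $b\neq 0$ and let $\mu>-1/2$. Assume $1\leq p,q,r\leq\infty$ and $\frac1p+\frac1q=\frac1r+1$. If $f\in L^p_\mu(\mathbb{R})$ and $g\in L^q_\mu(\mathbb{R})$, then $f\star g\in L^r_\mu(\mathbb{R})$ and $$\|f\star g\|_{\mu,r}\leq 4\,\|f\|_{\mu,p}\,\|g\|_{\mu,q}.$$ In particular, if $f,g\in L^1_\mu(\mathbb{R})$, then the quadratic-phase Dunkl convolution product $f\star g$ is defined almost everywhere on $\mathbb{R}$ and belongs to $L^1_\mu(\mathbb{R})$.
   Context: For $\mu>-1/2$, $L^p_\mu(\mathbb{R})$ is the space of measurable $f:\mathbb{R}\to\mathbb{C}$ with $\|f\|_{\mu,p}<\infty$, where $\|f\|_{\mu,p}=\left(\int_{\mathbb{R}}|f(v)|^p|v|^{2\mu+1}dv\right)^{1/p}$ for $1\le p<\infty$ and $\|f\|_{\mu,\infty}=\operatorname{ess\,sup}_{v\in\mathbb{R}}|f(v)|$. For nonzero real $x,y$ and real $z$ put $\sigma_{x,y,z}=\frac{x^2+y^2-z^2}{2xy}$. For $w,v,\kappa>0$ put $$K_\mu(w,v,\kappa)=\frac{2^{1-2\mu}\Gamma(\mu+1)}{\sqrt{\pi}\,\Gamma(\mu+1/2)}\,\frac{\left[((w+v)^2-\kappa^2)(\kappa^2-(w-v)^2)\right]^{\mu-1/2}}{(wv\kappa)^{2\mu}}\quad\text{if } |w-v|<\kappa<w+v,$$ and $K_\mu(w,v,\kappa)=0$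 otherwise. The Dunkl translation kernel is, for nonzero real $w,v,\kappa$, $$\mathcal{W}_\mu(w,v,\kappa)=\tfrac12\left\{1-\sigma_{w,v,\kappa}+\sigma_{\kappa,w,v}+\sigma_{\kappa,v,w}\right\}K_\mu(|w|,|v|,|\kappa|).$$ The quadratic-phase Dunkl translation kernel is $\mathcal{W}^{a,b,d}_\mu(w,v,\kappa)=\mathcal{W}_\mu(w,v,\kappa)\,e^{-i[a(w^2+v^2+\kappa^2)+d(w+v+\kappa)]}$, and the quadratic-phase Dunkl translation is $$\tau^{a,b,d}_{w,\mu}[f](v)=\int_{\mathbb{R}}f(\kappa)\,\mathcal{W}^{a,b,d}_\mu(w,v,\kappa)\,e^{i(a\kappa^2+d\kappa)}\,|\kappa|^{2\mu+1}\,d\kappa$$ (for $w,v\ne0$; the values at $w=0$ or $v=0$ are immaterial here). The quadratic-phase Dunkl convolution product is $$(f\star g)(w)=\int_{\mathbb{R}}\tau^{a,b,d}_{w,\mu}[f](-v)\,g(v)\,e^{i(av^2+dv)}\,|v|^{2\mu+1}\,dv .$$ *)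

(* Defs.v *)
From HB Require Import structures.
From mathcomp Require Import all_boot all_order all_algebra.
From mathcomp Require Import all_classical all_reals all_analysis.
From mathcomp Require Import ess_sup_inf complex.

Set Implicit Arguments.
Unset Strict Implicit.
Unset Printing Implicit Defensive.

Import Order.TTheory GRing.Theory Num.Theory.
Import numFieldNormedType.Exports.

Local Open Scope classical_set_scope.
Local Open Scope ring_scope.
Local Open Scope complex_scope.

Section QuadraticPhaseDunkl.
Context {R : realType}.

Local Notation leb := (@lebesgue_measure R).

(* Lebesgue integration of complex-valued functions, through real and imaginary
   parts. [cintegral] is total; it is meaningful when [cintegrable] holds. *)
Definition cmeasurable (F : R -> R[i]) : Prop :=
  measurable_fun setT (fun x => complex.Re (F x)) /\
  measurable_fun setT (fun x => complex.Im (F x)).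

Definition cintegrable (F : R -> R[i]) : Prop :=
  leb.-integrable setT (fun x => (complex.Re (F x))%:E) /\
  leb.-integrable setT (fun x => (complex.Im (F x))%:E).

Definition cintegral (F : R -> R[i]) : R[i] :=
  (\int[leb]_x complex.Re (F x)) +i* (\int[leb]_x complex.Im (F x)).

Definition cexpi (t : R) : R[i] := cos t +i* sin t.

(* Euler's integral, for s > 0 *)
Definition Gamma (s : R) : R :=
  \int[leb]_(t in `]0, +oo[) (t `^ (s - 1) * expR (- t)).

Definition weight (mu v : R) : R := `|v| `^ (2 * mu + 1).

(* Only used for 1 <= p <= +oo; the value at -oo is a dummy. For p = +oo the
   essential supremum is relative to Lebesgue measure. *)
Definition dunkl_norm (mu : R) (p : \bar R) (f : R -> R[i]) : \bar R :=
  match p with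
  | p'%:E => ((\int[leb]_v (Normc.normc (f v) `^ p' * weight mu v)%:E) `^ p'^-1)%E
  | +oo%E => ess_sup leb (fun v => (Normc.normc (f v))%:E)
  | -oo%E => 0%E
  end.

Definition dunkl_Lp (mu : R) (p : \bar R) (f : R -> R[i]) : Prop :=
  cmeasurable f /\ (dunkl_norm mu p f < +oo)%E.

Definition sigma (x y z : R) : R :=
  (x ^+ 2 + y ^+ 2 - z ^+ 2) / (2 * x * y).

Definition K_kernel (mu w v k : R) : R :=
  if `|w - v| < k < w + v then
    (2 `^ (1 - 2 * mu) * Gamma (mu + 1)) / (Num.sqrt pi * Gamma (mu + 2^-1)) *
    ((((w + v) ^+ 2 - k ^+ 2) * (k ^+ 2 - (w - v) ^+ 2)) `^ (mu - 2^-1) /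
     (w * v * k) `^ (2 * mu))
  else 0.

Definition W_kernel (mu w v k : R) : R :=
  2^-1 * (1 - sigma w v k + sigma k w v + sigma k v w) *
  K_kernel mu `|w| `|v| `|k|.

Definition QW_kernel (mu a d w v k : R) : R[i] :=
  (W_kernel mu w v k)%:C *
  cexpi (- (a * (w ^+ 2 + v ^+ 2 + k ^+ 2) + d * (w + v + k))).

Definition translation_integrand
    (mu a d : R) (f : R -> R[i]) (w v k : R) : R[i] :=
  f k * QW_kernel mu a d w v k * cexpi (a * k ^+ 2 + d * k) * (weight mu k)%:C.

(* On the null set w * v = 0 the value is whatever division by zero gives. *)
Definition translation (mu a d : R) (f : R -> R[i]) (w v : R) : R[i] :=
  cintegral (translation_integrand mu a d f w v).

Definition convolution_integrand
    (mu a d : R) (f g : R -> R[i]) (w v : R) : R[i] :=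
  translation mu a d f w (- v) * g v *
  cexpi (a * v ^+ 2 + d * v) * (weight mu v)%:C.

Definition convolution (mu a d : R) (f g : R -> R[i]) (w : R) : R[i] :=
  cintegral (convolution_integrand mu a d f g w).

(* Both Lebesgue integrals behind the convolution at w converge absolutely,
   the inner one for almost every v. *)
Definition convolution_defined
    (mu a d : R) (f g : R -> R[i]) (w : R) : Prop :=
  (\forall v \ae leb, cintegrable (translation_integrand mu a d f w (- v))) /\
  cintegrable (convolution_integrand mu a d f g w).

End QuadraticPhaseDunkl.

(* Main.v *)
Require Import Defs.
From HB Require Import structures.
From mathcomp Require Import all_boot all_order all_algebra.
From mathcomp Require Import all_classical all_reals all_analysis.
From mathcomp Require Import complex.
From mathcomp Require Import ring lra ess_sup_inf measurable_realfun.

(** The theorem is Young's inequality for a kernel with bounded marginals, because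
oscillation plays no part in it.

The phase factors have modulus 1. Where the Dunkl kernel does not vanish, |w|, |v|
and |k| are the sides of a triangle and each sigma is at most 1 in absolute value
([sigma_le1]), so |W(w,v,k)| is at most 2 K(|w|,|v|,|k|) ([W_kernel_le]). This
majorant is symmetric in its three arguments, and its integral over the line in any
one of them, for the weight |.|^(2 mu + 1), is at most 4 ([majorant_mass]). The last
fact is the normalization of K: the substitutions t = k^2 and t = w^2 + v^2 + 2 w v y
reduce the integral to that of (1 - y^2)^(mu - 1/2) over ]-1, 1[, which is compared
with the Gamma factors in [beta_gamma], itself a rearrangement of the Gauss integral.

Hence |f * g|(w) is at most the double integral of |g(v)| |f(k)| against a kernel
whose three marginals are at most C = 4, and such an operation maps L^p x L^q to L^r
with norm at most C ([kernel_young]). For F and G of norm at most 1 and finite p, q, weighted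
AM-GM bounds F G pointwise by a combination, with weights 1/r, 1 - 1/q and 1 - 1/p, of
G^q F^p, F^p and G^q. Integrated against the kernel, the last two terms are at most C
by two of the marginal bounds; a scale parameter left free in AM-GM is then adjusted
to give a pointwise bound of the r-th power by the integral of G^q F^p, and the third
marginal bound controls the integral of that in w.

The same inequality gives convergence almost everywhere: a finite L^r norm makes the
double integral finite for almost every w. That the inner integral converges for
almost every v, also where g vanishes, follows by replacing |g| with a positive
function of L^1 ([translation_defined_ae]). *)

Set Implicit Arguments.
Unset Strict Implicit.
Unset Printing Implicit Defensive.

Import Order.TTheory GRing.Theory Num.Theory.
Import numFieldNormedType.Exports.

Local Open Scope classical_set_scope.
Local Open Scope ring_scope.

(** * Measurability *)

Section Measurability.
Context {R : realType}.

(** The truncated power t_+^s. Writing the Gamma integrand, the Beta integrand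
and the Dunkl kernel with it makes them functions on the whole line, so that
changes of variables need not track domains of integration; it is still
homogeneous under positive factors. *)
Definition tpow (s t : R) : R := if 0 < t then t `^ s else 0.

Lemma tpow_ge0 s t : 0 <= tpow s t.
Proof. by rewrite /tpow; case: ifP => // _; exact: powR_ge0. Qed.

Lemma tpowM s c t : 0 < c -> tpow s (c * t) = c `^ s * tpow s t.
Proof.
move=> c0; rewrite /tpow pmulr_rgt0//; case: ifP => t0; last by rewrite mulr0.
by rewrite powRM// ltW.
Qed.

Lemma measurable_tpow s d (T : measurableType d) (f : T -> R) :
  measurable_fun setT f -> measurable_fun setT (fun x => tpow s (f x)).
Proof.
move=> mf; apply: measurable_fun_ifT => //.
  by apply: measurable_fun_ltr.
exact: (measurableT_comp (measurable_powR s)).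
Qed.

Section PointwiseMeasurability.
Context d (T : measurableType d).
Implicit Types f g : T -> R.

Lemma measurable_add f g : measurable_fun setT f -> measurable_fun setT g ->
  measurable_fun setT (fun x => f x + g x).
Proof. exact: measurable_funD. Qed.

Lemma measurable_mul f g : measurable_fun setT f -> measurable_fun setT g ->
  measurable_fun setT (fun x => f x * g x).
Proof. exact: measurable_funM. Qed.

Lemma measurable_opp f : measurable_fun setT f ->
  measurable_fun setT (fun x => - f x).
Proof. by move=> mf; exact: measurableT_comp. Qed.

Lemma measurable_norm f : measurable_fun setT f ->
  measurable_fun setT (fun x => `|f x|).
Proof. by move=> mf; exact: measurableT_comp. Qed.

Lemma measurable_pow n f : measurable_fun setT f ->
  measurable_fun setT (fun x => f x ^+ n).
Proof. exact: measurable_funX. Qed.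

Lemma measurable_exp f : measurable_fun setT f ->
  measurable_fun setT (fun x => expR (f x)).
Proof. by move=> mf; exact: measurableT_comp. Qed.

Lemma measurable_rpow r f : measurable_fun setT f ->
  measurable_fun setT (fun x => f x `^ r).
Proof. by move=> mf; exact: (measurableT_comp (measurable_powR r)). Qed.

(** Inversion is discontinuous at 0; it is reduced to a real power by
1/x = x * (x^2)^(-1), which also gives the value 0 at 0. *)
Lemma measurable_inv f : measurable_fun setT f ->
  measurable_fun setT (fun x => (f x)^-1).
Proof.
move=> mf; have -> : (fun x => (f x)^-1) = (fun x => f x * (f x ^+ 2) `^ (-1)).
  apply/funext => x; rewrite powR_inv1 ?sqr_ge0//.
  have [->|fx0] := eqVneq (f x) 0; first by rewrite invr0 mul0r.
  by rewrite expr2 invfM mulVKf.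
by apply: measurable_mul => //; apply: measurable_rpow; exact: measurable_pow.
Qed.

Lemma measurable_EFin f : measurable_fun setT f ->
  measurable_fun setT (fun x => (f x)%:E).
Proof. by move=> mf; apply/measurable_EFinP. Qed.

Lemma measurable_emul (f g : T -> \bar R) :
  measurable_fun setT f -> measurable_fun setT g ->
  measurable_fun setT (fun x => (f x * g x)%E).
Proof. exact: emeasurable_funM. Qed.

End PointwiseMeasurability.

End Measurability.

Lemma measurable_pair_of d d1 d2 (X : measurableType d)
  (T1 : measurableType d1) (T2 : measurableType d2) (f : X -> T1) (g : X -> T2) :
  measurable_fun setT f -> measurable_fun setT g ->
  measurable_fun setT (fun x => (f x, g x)).
Proof. exact: measurable_fun_pair. Qed.

Lemma measurable_fst_of d d1 d2 (X : measurableType d)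
  (T1 : measurableType d1) (T2 : measurableType d2) (f : X -> T1 * T2) :
  measurable_fun setT f -> measurable_fun setT (fun x => (f x).1).
Proof. by move=> mf; exact: (measurableT_comp measurable_fst). Qed.

Lemma measurable_snd_of d d1 d2 (X : measurableType d)
  (T1 : measurableType d1) (T2 : measurableType d2) (f : X -> T1 * T2) :
  measurable_fun setT f -> measurable_fun setT (fun x => (f x).2).
Proof. by move=> mf; exact: (measurableT_comp measurable_snd). Qed.


(** Measurability by recursion on the syntax of the function body. The head
symbol selects the lemma, since unification against each lemma in turn is too costly
for functions of several variables. *)
Ltac meas := lazymatch goal with
  | |- measurable_fun _ (fun _ => ?c) => exact: measurable_cst
  | |- measurable_fun _ (fun x => x) => exact: measurable_id
  | |- measurable_fun _ (fun x => EFin _) => apply: measurable_EFin; meas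
  | |- measurable_fun _ (fun x => mule _ _) => apply: measurable_emul; meas
  | |- measurable_fun _ (fun x => _ + _) => apply: measurable_add; meas
  | |- measurable_fun _ (fun x => - _) => apply: measurable_opp; meas
  | |- measurable_fun _ (fun x => _ * _) => apply: measurable_mul; meas
  | |- measurable_fun _ (fun x => _ ^-1) => apply: measurable_inv; meas
  | |- measurable_fun _ (fun x => _ ^+ _) => apply: measurable_pow; meas
  | |- measurable_fun _ (fun x => `|_|) => apply: measurable_norm; meas
  | |- measurable_fun _ (fun x => expR _) => apply: measurable_exp; meas
  | |- measurable_fun _ (fun x => powR _ _) => apply: measurable_rpow; meas
  | |- measurable_fun _ (fun x => tpow _ _) => apply: measurable_tpow; meas
  | |- measurable_fun _ (fun x => fst _) => apply: measurable_fst_of; meas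
  | |- measurable_fun _ (fun x => (_, _)) => apply: measurable_pair_of; meas
  | |- measurable_fun _ (fun x => snd _) => apply: measurable_snd_of; meas
  | mF : measurable_fun _ ?F |- measurable_fun _ (fun x => ?F _) =>
      apply: (measurableT_comp mF); meas
  | |- measurable_fun _ (tpow _) => apply: measurable_tpow; exact: measurable_id
  | |- measurable_fun _ fst => exact: measurable_fst
  | |- measurable_fun _ snd => exact: measurable_snd
  | |- measurable_fun _ (@GRing.opp _) => apply: measurable_opp; exact: measurable_id
  | |- measurable_fun _ expR => apply: measurable_exp; exact: measurable_id
  | _ => first [ assumption | idtac ]
  end.

(** * The Beta integral *)

Section RealIntegrals.
Context {R : realType}.
Local Notation leb := (@lebesgue_measure R).

Lemma measurable_affine (c d : R) : measurable_fun setT (fun x : R => c * x + d).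
Proof. by apply: measurable_funD => //; exact: measurable_funM. Qed.

(** The measure A |-> c * leb ((x |-> c x + d)^-1 A) agrees with Lebesgue measure
on half-open intervals, hence everywhere. *)
Lemma ge0_integral_affine (f : R -> \bar R) (c d : R) : 0 < c ->
  measurable_fun setT f -> (forall x, 0 <= f x)%E ->
  (\int[leb]_x f x = c%:E * \int[leb]_x f (c * x + d)%R)%E.
Proof.
move=> c0 mf f0.
have mphi : measurable_fun [set: R] (fun x : R => c * x + d : measurableTypeR R)
  by exact: measurable_affine.
have cge0 : 0 <= c by exact: ltW.
unshelve epose (nu := mscale (NngNum cge0) (pushforward leb (fun x : R => c * x + d : measurableTypeR R))
  : {measure set (measurableTypeR R) -> \bar R}); first exact: mphi.
have nuE A : nu A = (c%:E * leb ((fun x : R => (c * x + d)%R) @^-1` A))%E by [].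
have lebE A : measurable A -> leb A = nu A.
  move=> mA; apply: (@lebesgue_measure_unique R nu) => // _ [[a b]] _ <-.
  rewrite nuE.
  rewrite [X in (_ * leb X)%E](_ : _ = `](a - d) / c, (b - d) / c]%classic); last first.
    apply/seteqP; split=> x /=; rewrite !in_itv /= ltr_pdivrMr// ler_pdivlMr//;
      by rewrite ltrBlDr lerBrDr (mulrC x).
  rewrite !lebesgue_measure_itv /= !lte_fin ltr_pM2r ?invr_gt0// ltrD2r.
  case: ifPn => _; last by rewrite mule0.
  rewrite -!EFinB -EFinM; congr (_%:E); field; by rewrite gt_eqF.
transitivity (\int[nu]_x f x)%E.
  by apply: eq_measure_integral => A mA _; exact: lebE.
rewrite ge0_integral_mscale// ge0_integral_pushforward//.
Qed.
Definition gamma_int (s : R) : \bar R :=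
  (\int[leb]_t (tpow (s - 1) t * expR (- t))%:E)%E.

Lemma GammaE s : Gamma s = fine (gamma_int s).
Proof.
rewrite /Gamma /Rintegral; congr fine; rewrite /gamma_int integral_mkcond.
apply: eq_integral => t _; rewrite /patch /tpow.
by rewrite mem_setE in_itv/= andbT; case: ifP => //; rewrite mul0r.
Qed.

(** For s > 0 this is the Beta value B(s, 1/2), in the form of the integral of
(1 - y^2)^(s-1) over ]-1, 1[. *)
Definition beta_int (s : R) : \bar R :=
  (\int[leb]_y (tpow (s - 1) (1 - y ^+ 2))%:E)%E.

(** The square root of pi is taken as the Gauss integral. In the double integral
of exp(-x^2) t_+^(s-1) exp(-t), put t = u - x^2, so that the exponentials combine
to exp(-u); exchange the integrals and put x = sqrt u * y. Only nonnegative
integrals occur, so the identity holds in [0, +oo]. *)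
Lemma beta_gamma s :
  (gamma_int s * (Num.sqrt pi)%:E = gamma_int (s + 2^-1) * beta_int s)%E.
Proof.
pose h (z : measurableTypeR R * measurableTypeR R) : \bar R :=
  (tpow (s - 1) (z.2 - z.1 ^+ 2) * expR (- z.2))%:E.
have h0 z : (0 <= h z)%E by rewrite lee_fin mulr_ge0 ?tpow_ge0 ?expR_ge0.
have mh : measurable_fun setT h by rewrite /h; meas.
have mg : measurable_fun setT (fun t : R => (tpow (s - 1) t * expR (- t))%:E).
  by meas.
have g0 t : (0 <= (tpow (s - 1) t * expR (- t))%:E)%E.
  by rewrite lee_fin mulr_ge0 ?tpow_ge0 ?expR_ge0.
have gam0 r : (0 <= gamma_int r)%E.
  by apply: integral_ge0 => t _; rewrite lee_fin mulr_ge0 ?tpow_ge0 ?expR_ge0.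
rewrite -integralT_gauss -ge0_integralZl//; last 2 first.
- by apply/measurable_EFinP; exact: measurable_gauss_fun.
- by move=> x _; rewrite lee_fin gauss_fun_ge0.
transitivity (\int[leb]_x \int[leb]_u h (x, u))%E.
  apply: eq_integral => x _.
  (* t = u - x^2, for fixed x *)
  rewrite /gamma_int (@ge0_integral_affine _ 1 (- x ^+ 2))// mul1e muleC.
  rewrite -ge0_integralZl//; last 2 first.
  - by meas.
  - by rewrite lee_fin gauss_fun_ge0.
  apply: eq_integral => u _; rewrite /h /= -EFinM mul1r /gauss_fun; congr EFin.
  rewrite mulrCA -expRD; congr (_ * expR _); ring.
rewrite fubini_tonelli//.
rewrite /gamma_int -ge0_integralZr//; last 3 first.
- by meas.
- by move=> t _; rewrite lee_fin mulr_ge0 ?tpow_ge0 ?expR_ge0.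
- by apply: integral_ge0 => t _; rewrite lee_fin tpow_ge0.
apply: eq_integral => u _.
have [u0|u0] := ltP 0 u; last first.
  rewrite integral0_eq; last first.
    move=> x _; rewrite /h/= /tpow ifF ?mul0r//; apply/negbTE; rewrite -leNgt.
    by rewrite subr_le0 (le_trans u0)// sqr_ge0.
  by rewrite /tpow ltNge u0 /= mul0r mul0e.
(* x = sqrt u * y, for fixed u > 0 *)
have mhu : measurable_fun setT (fun x : R => h (x, u)) by rewrite /h /=; meas.
rewrite (@ge0_integral_affine _ (Num.sqrt u) 0) ?sqrtr_gt0//.
under eq_integral => y _.
  rewrite /h /= addr0 exprMn sqr_sqrtr ?ltW// -{1}(mulr1 u) -mulrBr tpowM//.
  rewrite mulrAC EFinM.
  over.
rewrite ge0_integralZl//; last 3 first.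
- by meas.
- by move=> y _; rewrite lee_fin tpow_ge0.
- by rewrite lee_fin mulr_ge0 ?powR_ge0 ?expR_ge0.
rewrite muleA -EFinM; congr (_%:E * _)%E.
rewrite mulrA; congr *%R.
rewrite /tpow u0 -powR12_sqrt ?ltW// -powRD; last first.
  by rewrite (gt_eqF u0) /= implybT.
congr powR; ring.
Qed.

End RealIntegrals.

(** * The substitution t = x^2 *)

Section SquareSubstitution.
Context {R : realType}.
Local Notation leb := (@lebesgue_measure R).

Lemma continuous_tpow (s t : R) : 0 < t -> {for t, continuous (tpow s)}.
Proof.
move=> t0; have cp : {for t, continuous (fun x : R => x `^ s)}.
  apply: differentiable_continuous; apply/derivable1_diffP.
  by apply: derivable_powR; rewrite in_itv/= t0.
rewrite /prop_for /continuous_at /tpow t0.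
apply: cvg_trans cp; apply: near_eq_cvg.
near=> x; rewrite ifT//; near: x; exact: lt_nbhsr.
Unshelve. all: by end_near. Qed.

Lemma integral_square_closed (h : R -> R) (a b : R) : 0 <= a ->
  (forall x, 0 <= h x) -> measurable_fun setT h ->
  (a <= b -> {in `[a ^+ 2, b ^+ 2], continuous h}) ->
  (\int[leb]_(x in `[a, b]) (h (x ^+ 2) * (2 * x))%:E <= \int[leb]_x (h x)%:E)%E.
Proof.
move=> a0 h0 mh ch.
have [ab|ba] := leP a b; last first.
  rewrite set_itv_ge ?bnd_simp -?ltNge//= integral_set0.
  by apply: integral_ge0 => x _; rewrite lee_fin.
have d1 : (fun x : R => x ^+ 2)^`()%classic = (fun x => 2 * x).
  apply/funext => x; by rewrite exp_derive1 /= expr1.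
have c1 : continuous (fun x : R => 2 * x).
  by move=> x; apply: cvgM; [exact: cvg_cst|exact: cvg_id].
have c2 : continuous (fun x : R => x ^+ 2) by move=> x; exact: exprn_continuous.
have := @integration_by_substitution_increasing R (fun x => x ^+ 2) h a b ab.
rewrite d1 => <-.
- apply: ge0_subset_integral => //.
  by apply: measurable_funTS; exact: measurable_EFin.
- by move=> x _; rewrite lee_fin.
- move=> x y; rewrite !in_itv/= => /andP[ax xb] /andP[ay yb] xy.
  by rewrite ltrXn2r// ?nnegrE (le_trans a0).
- by move=> x _; exact: c1.
- by apply/cvg_ex; exists (2 * a); apply: cvg_at_right_filter; exact: c1.
- by apply/cvg_ex; exists (2 * b); apply: cvg_at_left_filter; exact: c1.
- split.
  + by move=> x _; exact: exprn_derivable.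
  + apply: cvg_at_right_filter; exact: c2.
  + apply: cvg_at_left_filter; exact: c2.
- apply: continuous_in_subspaceT => x; rewrite inE => xab; exact: (ch ab).
Qed.

(** The substitution t = x^2 up to an inequality, which is all that an upper bound
on the mass of the kernel needs. The function h may blow up at both ends of
]A^2, B^2[ (it does for the Dunkl kernel of order less than 1/2), so the
substitution is made on the compact intervals [A + 1/(n+1), B - 1/(n+1)] and
passed to the limit by monotone convergence. *)
Lemma integral_square_open (h : R -> R) (A B : R) : 0 <= A ->
  (forall x, 0 <= h x) -> measurable_fun setT h ->
  {in `]A ^+ 2, B ^+ 2[, continuous h} ->
  (\int[leb]_(x in `]A, B[) (h (x ^+ 2) * (2 * x))%:E <= \int[leb]_x (h x)%:E)%E.
Proof.
move=> A0 h0 mh ch.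
pose F n := `[A + n.+1%:R^-1, B - n.+1%:R^-1]%classic : set R.
have FE : `]A, B[%classic = \bigcup_n F n.
  apply/seteqP; split=> x /=.
    rewrite in_itv/= => /andP[Ax xB].
    have [n nx] := ltr_add_invr Ax; have [m mx] := ltr_add_invr xB.
    exists (maxn n m) => //=; rewrite /F /= in_itv/=; apply/andP; split.
      apply: le_trans (ltW nx); rewrite lerD2l lef_pV2 ?posrE ?ltr0n//.
      by rewrite ler_nat ltnS leq_maxl.
    rewrite lerBrDr; apply: le_trans (ltW mx).
    by rewrite lerD2l lef_pV2 ?posrE ?ltr0n// ler_nat ltnS leq_maxr.
  move=> [n _]; rewrite /F /= !in_itv/= => /andP[h1 h2].
  have n0 : (0 : R) < n.+1%:R^-1 by rewrite invr_gt0 ltr0n.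
  by apply/andP; split; [apply: lt_le_trans h1; rewrite ltrDl|
    apply: le_lt_trans h2 _; rewrite gtrBl].
have mg D : measurable_fun D (fun x : R => (h (x ^+ 2) * (2 * x))%:E).
  apply: measurable_funTS; apply: measurable_EFin; apply: measurable_mul; last by meas.
  by apply: (measurableT_comp mh); meas.
rewrite FE.
have cv : (\int[leb]_(x in F i) (h (x ^+ 2) * (2 * x))%:E @[i --> \oo] -->
   \int[leb]_(x in \bigcup_i F i) (h (x ^+ 2) * (2 * x))%:E)%E.
  apply: (@ge0_nondecreasing_set_cvg_integral _ (measurableTypeR R)).
  - move=> n m nm; apply/subsetPset => x; rewrite /F /= !in_itv/= => /andP[h1 h2].
    have le : m.+1%:R^-1 <= n.+1%:R^-1 :> R.
      by rewrite lef_pV2 ?posrE ?ltr0n// ler_nat ltnS.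
    apply/andP; split.
      by apply: le_trans h1; rewrite lerD2l.
    by apply: le_trans h2 _; rewrite lerD2l lerN2.
  - by move=> i; exact: measurable_itv.
  - by move=> i; exact: mg.
  - move=> i x; rewrite /F /= in_itv/= => /andP[h1 h2].
    rewrite lee_fin mulr_ge0// mulr_ge0// (le_trans _ h1)// addr_ge0//.
rewrite -(cvg_lim _ cv)//; apply: lime_le; first by apply/cvg_ex; eexists; exact: cv.
near=> n; apply: integral_square_closed => //.
  by rewrite addr_ge0.
move=> ab; have n0 : (0 : R) < n.+1%:R^-1 by rewrite invr_gt0 ltr0n.
move=> x; rewrite in_itv/= => /andP[h1 h2]; apply: ch; rewrite in_itv/=.
have nB : B - n.+1%:R^-1 < B by rewrite gtrBl.
have An : A < A + n.+1%:R^-1 by rewrite ltrDl.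
apply/andP; split.
  by apply: lt_le_trans h1; rewrite ltrXn2r// ?nnegrE ?(ltW (le_lt_trans A0 An)).
apply: le_lt_trans h2 _; have B0 := le_trans (ltW (le_lt_trans A0 An)) ab.
by rewrite ltrXn2r// ?nnegrE// (le_trans B0 (ltW nB)).
Unshelve. all: by end_near. Qed.
End SquareSubstitution.

(** * Symmetry and mass of the Dunkl kernel *)

Section Kernel.
Context {R : realType}.
Local Notation leb := (@lebesgue_measure R).

Lemma ge0_integral_opp (f : R -> \bar R) :
  measurable_fun setT f -> (forall x, 0 <= f x)%E ->
  (\int[leb]_x f (- x)%R = \int[leb]_x f x)%E.
Proof.
move=> mf f0.
have mN : measurable_fun [set: measurableTypeR R] (-%R : R -> measurableTypeR R).
  exact: oppr_measurable.
have := @ge0_integral_pushforward _ _ _ _ R _ mN leb setT f measurableT mf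
  (fun y _ => f0 y).
rewrite preimage_setT => <-.
by apply: eq_measure_integral => A mA _; rewrite -[RHS]lebesgue_measureN.
Qed.

Lemma ge0_integral_even (f : R -> R) (a b : R) : 0 <= a ->
  measurable_fun setT f -> (forall x, 0 <= f x) -> (forall x, f (- x) = f x) ->
  (forall x, ~~ (a < `|x| < b) -> f x = 0) ->
  (\int[leb]_x (f x)%:E = 2%:E * \int[leb]_(x in `]a, b[) (f x)%:E)%E.
Proof.
move=> a0 mf f0 fN f00.
pose g x := if a < x < b then f x else 0.
have mg : measurable_fun setT g.
  apply: measurable_fun_ifT => //.
  by apply: measurable_and; exact: measurable_fun_ltr.
have g0 x : 0 <= g x by rewrite /g; case: ifP.
have fE x : f x = g x + g (- x).
  rewrite /g fN; case: (ltP 0 x) => x0.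
    rewrite [X in _ + X]ifF ?addr0; last first.
      by apply/negbTE; rewrite negb_and -leNgt (le_trans _ a0)// oppr_le0 ltW.
    by case: ifPn => //; rewrite -{1 2}(gtr0_norm x0); exact: f00.
  rewrite ifF ?add0r; last first.
    by apply/negbTE; rewrite negb_and -leNgt (le_trans _ a0).
  by case: ifPn => //; rewrite -{1 2}(ler0_norm x0); exact: f00.
under eq_integral do rewrite fE EFinD.
rewrite ge0_integralD//; last 4 first.
- by move=> x _; rewrite lee_fin.
- exact: measurable_EFin.
- by move=> x _; rewrite lee_fin.
- by apply: measurable_EFin; apply: (measurableT_comp mg); meas.
rewrite (@ge0_integral_opp (fun x => (g x)%:E)) => [||x]; last 2 first.
- exact: measurable_EFin.
- by rewrite lee_fin.
rewrite -mule2n muleC -mule_natl muleC; congr (_ * _)%E.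
rewrite [RHS]integral_mkcond; apply: eq_integral => x _; rewrite /patch /g.
by rewrite mem_setE in_itv/=; case: ifP.
Qed.

Lemma gamma_int_ge0 s : (0 <= @gamma_int R s)%E.
Proof.
by apply: integral_ge0 => t _; rewrite lee_fin mulr_ge0 ?tpow_ge0 ?expR_ge0.
Qed.

Lemma beta_int_ge0 s : (0 <= @beta_int R s)%E.
Proof. by apply: integral_ge0 => t _; rewrite lee_fin tpow_ge0. Qed.

Lemma Gamma_ge0 (s : R) : 0 <= Gamma s.
Proof. by rewrite GammaE fine_ge0// gamma_int_ge0. Qed.

(** An inequality rather than an equality: Gamma is read off an extended
real integral and is 0 when that integral diverges; the left-hand side is then
0. *)
Lemma Gamma_beta_le1 (s : R) :
  ((Gamma (s + 2^-1) / (Num.sqrt pi * Gamma s))%:E * beta_int s <= 1)%E.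
Proof.
have := beta_gamma s; rewrite !GammaE.
move: (gamma_int_ge0 s) (gamma_int_ge0 (s + 2^-1)) (beta_int_ge0 s).
have p0 : 0 < Num.sqrt (pi : R) by rewrite sqrtr_gt0 pi_gt0.
case: (gamma_int s) => [g| |]//=; last first.
  by move=> *; rewrite mulr0 invr0 mulr0 !mul0e.
case: (gamma_int (s + 2^-1)) => [g'| |]//=; last first.
  by move=> *; rewrite mul0r mul0e.
rewrite !lee_fin => g0 g'0 b0.
have [->|gn0] := eqVneq g 0; first by rewrite mulr0 invr0 mulr0 !mul0e.
have [->|g'n0] := eqVneq g' 0; first by rewrite mul0r !mul0e.
case: (beta_int s) b0 => [b| |]//= b0; last first.
  by rewrite gt0_muley// lte_fin lt_neqAle eq_sym g'n0.
rewrite -!EFinM => -[gE]; rewrite lee_fin.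
have -> : g' / (Num.sqrt pi * g) * b = (g' * b) / (Num.sqrt pi * g) by field; rewrite gn0 gt_eqF.
by rewrite -gE [g * _]mulrC divff// mulf_neq0// gt_eqF.
Qed.

Section FixedOrder.
Variable mu : R.

Lemma K_kernel_ge0 (w v k : R) : 0 <= K_kernel mu w v k.
Proof.
rewrite /K_kernel; case: ifP => // _; rewrite mulr_ge0//.
  by rewrite divr_ge0 ?mulr_ge0 ?powR_ge0 ?Gamma_ge0 ?sqrtr_ge0.
by rewrite divr_ge0 ?powR_ge0.
Qed.

Lemma measurable_K_kernel d (T : measurableType d) (f g h : T -> R) :
  measurable_fun setT f -> measurable_fun setT g -> measurable_fun setT h ->
  measurable_fun setT (fun x => K_kernel mu (f x) (g x) (h x)).
Proof.
move=> mf mg mh; apply: measurable_fun_ifT => //.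
  by apply: measurable_and; apply: measurable_fun_ltr => //; meas.
by apply: measurable_mul => //; meas.
Qed.

Lemma measurable_weight : measurable_fun setT (@weight R mu).
Proof. by rewrite /weight; meas. Qed.

Lemma weight_ge0 (v : R) : 0 <= weight mu v.
Proof. exact: powR_ge0. Qed.

(** Both sides say that w, v, k are the sides of a nondegenerate triangle. *)
Lemma triangle_sym (w v k : R) : 0 <= w -> 0 <= v -> 0 <= k ->
  (`|w - v| < k < w + v) = (`|w - k| < v < w + k).
Proof. by move=> w0 v0 k0; rewrite !ltr_norml; lra. Qed.

Lemma K_kernelC (w v k : R) : K_kernel mu w v k = K_kernel mu v w k.
Proof.
rewrite /K_kernel distrC (addrC w v); case: ifP => // _.
by congr (_ * (_ `^ _ / _ `^ _)); ring.
Qed.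

(** The bracket ((w+v)^2 - k^2)(k^2 - (w-v)^2) is 16 times the squared area of the
triangle with sides w, v, k, hence symmetric in the three sides. *)
Lemma K_kernelCr (w v k : R) : 0 <= w -> 0 <= v -> 0 <= k ->
  K_kernel mu w v k = K_kernel mu w k v.
Proof.
move=> w0 v0 k0; rewrite /K_kernel -triangle_sym//; case: ifP => // _.
by congr (_ * (_ `^ _ / _ `^ _)); ring.
Qed.

(** For mu > -1/2 the kernel is a probability density on k > 0 for k^(2 mu + 1) dk:
with t = k^2 the bracket becomes (2wv)^2 - (t - w^2 - v^2)^2, and
t = w^2 + v^2 + 2 w v y turns the integral into the Beta integral which the
constant of the kernel normalizes. The whole line gives twice that. *)
Lemma K_kernel_mass_pos (w v : R) : 0 < w -> 0 < v ->
  (\int[leb]_k (K_kernel mu w v `|k| * weight mu k)%:E <= 2%:E)%E.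
Proof.
move=> w0 v0.
pose h t : R := tpow (mu - 2^-1) ((2 * w * v) ^+ 2 - (t - (w ^+ 2 + v ^+ 2)) ^+ 2).
have h0 x : 0 <= h x by exact: tpow_ge0.
have mh : measurable_fun setT h by rewrite /h; meas.
have wv0 : 0 < w * v by rewrite mulr_gt0.
have c0 : 0 < 2 * w * v by rewrite -mulrA mulr_gt0.
pose D := Gamma (mu + 1) / (Num.sqrt pi * Gamma (mu + 2^-1)).
have D0 : 0 <= D by rewrite divr_ge0 ?mulr_ge0 ?sqrtr_ge0 ?Gamma_ge0.
pose C := 2 `^ (1 - 2 * mu) * D / (w * v) `^ (2 * mu).
have C0 : 0 <= C.
  by rewrite divr_ge0 ?powR_ge0// mulr_ge0 ?powR_ge0.
have XE x : ((w + v) ^+ 2 - x ^+ 2) * (x ^+ 2 - (w - v) ^+ 2) =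
   (2 * w * v) ^+ 2 - (x ^+ 2 - (w ^+ 2 + v ^+ 2)) ^+ 2 by ring.
have X0 x : x \in `](`|w - v| ^+ 2), ((w + v) ^+ 2)[ ->
    0 < (2 * w * v) ^+ 2 - (x - (w ^+ 2 + v ^+ 2)) ^+ 2.
  rewrite in_itv/= real_normK ?num_real// => /andP[h1 h2].
  have -> : (2 * w * v) ^+ 2 - (x - (w ^+ 2 + v ^+ 2)) ^+ 2 =
    ((w + v) ^+ 2 - x) * (x - (w - v) ^+ 2) by ring.
  by rewrite mulr_gt0 ?subr_gt0.
have hint : (\int[leb]_t (h t)%:E =
    ((2 * w * v) `^ (2 * mu))%:E * beta_int (mu + 2^-1))%E.
  have mEh : measurable_fun setT (fun t => (h t)%:E) by exact: measurable_EFin.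
  have Eh0 t : (0 <= (h t)%:E)%E by rewrite lee_fin.
  (* t = w^2 + v^2 + 2 w v y *)
  rewrite (ge0_integral_affine (w ^+ 2 + v ^+ 2) c0 mEh Eh0).
  under eq_integral => y _.
    rewrite /h [X in tpow _ X](_ : _ = (2 * w * v) ^+ 2 * (1 - y ^+ 2)); last by ring.
    rewrite tpowM ?exprn_gt0// EFinM (_ : mu - 2^-1 = mu + 2^-1 - 1); last by lra.
    over.
  rewrite ge0_integralZl//; last 3 first.
  - by meas.
  - by move=> y _; rewrite lee_fin tpow_ge0.
  - by rewrite lee_fin powR_ge0.
  rewrite muleA -EFinM; congr (_%:E * _)%E.
  rewrite -powR_mulrn ?ltW// -powRrM -{1}[2 * w * v]powRr1 ?ltW// -powRD; last first.
    by rewrite (gt_eqF c0) /= implybT.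
  by congr powR; lra.
have intE (x : R) : `|w - v| < x < w + v ->
    K_kernel mu w v `|x| * weight mu x = C / 2 * (h (x ^+ 2) * (2 * x)).
  move=> /andP[h1 h2]; have x0 : 0 < x by apply: le_lt_trans h1.
  have X1 : 0 < (2 * w * v) ^+ 2 - (x ^+ 2 - (w ^+ 2 + v ^+ 2)) ^+ 2.
    have wv1 : 0 <= w + v by rewrite addr_ge0 ?ltW.
    by apply: X0; rewrite in_itv/= !ltrXn2r// ?nnegrE ?normr_ge0 ?(ltW x0).
  rewrite gtr0_norm// /K_kernel h1 h2 /= XE /h /tpow X1 /weight gtr0_norm//.
  rewrite /C /D powRM ?ltW// [x `^ (2 * mu + 1)]powRD; last first.
    by rewrite (gt_eqF x0) implybT.
  rewrite [x `^ 1]powRr1 ?ltW//.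
  have n1 : x `^ (2 * mu) != 0 by rewrite gt_eqF// powR_gt0.
  have n2 : (w * v) `^ (2 * mu) != 0 by rewrite gt_eqF// powR_gt0.
  set a := 2 `^ _; set b := _ `^ (mu - _); set x' := x `^ _ in n1 *; set y' := (w * v) `^ _ in n2 *.
  set q := (Num.sqrt pi * _)^-1.
  by field; rewrite n1 n2.
rewrite (@ge0_integral_even _ `|w - v| (w + v))//; last 4 first.
- apply: measurable_mul; last exact: measurable_weight.
  by apply: measurable_K_kernel; meas.
- by move=> x; rewrite mulr_ge0 ?K_kernel_ge0 ?weight_ge0.
- by move=> x; rewrite /weight normrN.
- by move=> x /negbTE xn; rewrite /K_kernel xn mul0r.
under eq_integral => x.
  rewrite inE/= in_itv/= => xwv; rewrite intE// EFinM.
  over.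
rewrite ge0_integralZl//; last 3 first.
- apply: measurable_funTS; apply: measurable_EFin; apply: measurable_mul; last by meas.
  by apply: (measurableT_comp mh); meas.
- move=> x /=; rewrite in_itv/= => /andP[h1 _].
  by rewrite lee_fin !mulr_ge0// (le_trans _ (ltW h1)).
- by rewrite lee_fin divr_ge0.
rewrite muleA -EFinM (_ : 2 * (C / 2) = C); last by field.
apply: (@le_trans _ _ (C%:E * \int[leb]_t (h t)%:E)%E).
  apply: lee_wpmul2l; first by rewrite lee_fin.
  apply: integral_square_open => // x /X0 X1.
  apply: (@continuous_comp _ _ _
    (fun t : R => (2 * w * v) ^+ 2 - (t - (w ^+ 2 + v ^+ 2)) ^+ 2)
    (tpow (mu - 2^-1))).
    apply: cvgB; first exact: cvg_cst.
    apply: (@continuous_comp _ _ _ (fun t : R => t - (w ^+ 2 + v ^+ 2)) (fun t : R => t ^+ 2)).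
      by apply: cvgB; [exact: cvg_id|exact: cvg_cst].
    exact: exprn_continuous.
  exact: continuous_tpow.
rewrite hint muleA -EFinM.
have -> : C * (2 * w * v) `^ (2 * mu) = 2 * D.
  rewrite /C -(mulrA 2 w v) [(2 * (w * v)) `^ _]powRM ?ltW// powRB ?powRr1//; last by rewrite pnatr_eq0 implybT.
  have n2 : (w * v) `^ (2 * mu) != 0 by rewrite gt_eqF// powR_gt0.
  have n3 : 2 `^ (2 * mu) != 0 :> R by rewrite gt_eqF// powR_gt0.
  by field; rewrite n2 n3.
rewrite EFinM -muleA -[leRHS]mule1; apply: lee_wpmul2l => //.
have := Gamma_beta_le1 (mu + 2^-1).
by rewrite (_ : mu + 2^-1 + 2^-1 = mu + 1); last by lra.
Qed.

Lemma K_kernel_mass (w v : R) :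
  (\int[leb]_k (K_kernel mu `|w| `|v| `|k| * weight mu k)%:E <= 2%:E)%E.
Proof.
have K0 (x y : R) : x = 0 \/ y = 0 -> forall k, K_kernel mu `|x| `|y| k = 0.
  move=> xy k; rewrite /K_kernel ifF//; apply/negbTE; apply/negP => /andP[].
  by case: xy => ->; rewrite normr0 ?sub0r ?subr0 ?add0r ?addr0 ?normrN normr_id;
    move=> h1 h2; have := lt_trans h1 h2; rewrite ltxx.
have [->|w0] := eqVneq w 0.
  by rewrite integral0_eq// => k _; rewrite K0 ?mul0r//; left.
have [->|v0] := eqVneq v 0.
  by rewrite integral0_eq// => k _; rewrite K0 ?mul0r//; right.
by apply: K_kernel_mass_pos; rewrite normr_gt0.
Qed.

(** By the cosine rule, sigma is up to sign the cosine of the angle between the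
sides |x| and |y| of a triangle with third side |z|. *)
Lemma sigma_le1 (x y z : R) : `| `|x| - `|y| | < `|z| < `|x| + `|y| ->
  `|sigma x y z| <= 1.
Proof.
move=> /andP[h1 h2].
have z2a : (`|x| - `|y|) ^+ 2 < z ^+ 2.
  by rewrite -(real_normK (num_real z)) -real_normK ?num_real// ltrXn2r.
have z2b : z ^+ 2 < (`|x| + `|y|) ^+ 2.
  by rewrite -(real_normK (num_real z)) ltrXn2r// ?nnegrE ?addr_ge0.
have [xy0|xy0] := eqVneq (x * y) 0.
  by rewrite /sigma -mulrA xy0 mulr0 invr0 mulr0 normr0.
have p0 : 0 < `|2 * x * y| by rewrite -mulrA normr_gt0 mulf_neq0.
rewrite /sigma normrM normfV ler_pdivrMr// mul1r !normrM (ger0_norm (ler0n _ 2)).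
rewrite ler_norml; move: z2a z2b; rewrite -[x ^+ 2](real_normK (num_real x)).
rewrite -[y ^+ 2](real_normK (num_real y)); move: `|x| `|y| => a b.
by move=> *; apply/andP; split; nra.
Qed.

(** The factor 2 bounds half of |1 - sigma + sigma + sigma|. Unlike the Dunkl
kernel itself, this majorant is symmetric in its three arguments, so one mass
estimate serves for all three. *)
Definition majorant (w v k : R) : R := 2 * K_kernel mu `|w| `|v| `|k|.

Lemma majorant_ge0 w v k : 0 <= majorant w v k.
Proof. by rewrite mulr_ge0 ?K_kernel_ge0. Qed.

Lemma majorantC w v k : majorant w v k = majorant v w k.
Proof. by rewrite /majorant K_kernelC. Qed.

Lemma majorantCr w v k : majorant w v k = majorant w k v.
Proof. by rewrite /majorant K_kernelCr. Qed.

Lemma majorantN w v k : majorant w (- v) k = majorant w v k.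
Proof. by rewrite /majorant normrN. Qed.

Lemma measurable_majorant d (T : measurableType d) (f g h : T -> R) :
  measurable_fun setT f -> measurable_fun setT g -> measurable_fun setT h ->
  measurable_fun setT (fun x => majorant (f x) (g x) (h x)).
Proof.
move=> mf mg mh; apply: measurable_mul; first by meas.
by apply: measurable_K_kernel; meas.
Qed.

Lemma majorant_mass w v :
  (\int[leb]_k (majorant w v k * weight mu k)%:E <= 4%:E)%E.
Proof.
under eq_integral do rewrite /majorant -mulrA EFinM.
rewrite ge0_integralZl//; last 2 first.
- apply: measurable_EFin; apply: measurable_mul; last exact: measurable_weight.
  by apply: measurable_K_kernel; meas.
- by move=> k _; rewrite lee_fin mulr_ge0 ?K_kernel_ge0 ?weight_ge0.
rewrite (_ : 4 = 2 * 2); last by rewrite -natrM.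
by rewrite EFinM; apply: lee_wpmul2l => //; exact: K_kernel_mass.
Qed.

Lemma W_kernel_le w v k : `|W_kernel mu w v k| <= majorant w v k.
Proof.
rewrite /W_kernel /majorant normrM (ger0_norm (K_kernel_ge0 _ _ _)).
have [T|nT] := boolP (`| `|w| - `|v| | < `|k| < `|w| + `|v|); last first.
  by rewrite /K_kernel (negbTE nT) !mulr0.
apply: ler_wpM2r; first exact: K_kernel_ge0.
have s1 := sigma_le1 T.
have s2 : `|sigma k w v| <= 1.
  by apply: sigma_le1; rewrite distrC (addrC `|k|) -triangle_sym.
have s3 : `|sigma k v w| <= 1.
  by apply: sigma_le1; rewrite distrC (addrC `|k|) -triangle_sym// distrC (addrC `|v|).
move: s1 s2 s3; rewrite !ler_norml => *; lra.
Qed.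

End FixedOrder.
End Kernel.

(** * Young's inequality for a kernel *)

(** With L the weighted sum of the logarithms, t >= exp L (1 + ln t - L) for each
of x, y, z by convexity of exp; the weighted sum of the three bounds is exp L. *)
Lemma weighted_AMGM3 (R : realType) (a b c x y z : R) :
  0 <= a -> 0 <= b -> 0 <= c -> a + b + c = 1 -> 0 < x -> 0 < y -> 0 < z ->
  x `^ a * y `^ b * z `^ c <= a * x + b * y + c * z.
Proof.
move=> a0 b0 c0 abc x0 y0 z0.
pose L := a * ln x + b * ln y + c * ln z.
have -> : x `^ a * y `^ b * z `^ c = expR L.
  by rewrite /powR !gt_eqF// -!expRD.
have H t : 0 < t -> expR L * (1 + (ln t - L)) <= t.
  move=> t0; have tE : t = expR L * expR (ln t - L).
    by rewrite -expRD addrC subrK lnK.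
  by rewrite [leRHS]tE ler_wpM2l ?expR_ge0// expR_ge1Dx.
have hx := ler_wpM2l a0 (H _ x0); have hy := ler_wpM2l b0 (H _ y0).
have hz := ler_wpM2l c0 (H _ z0).
apply: le_trans (lerD (lerD hx hy) hz).
rewrite [leRHS](_ : _ = expR L * ((a + b + c) * (1 - L) + L)); last by rewrite /L; ring.
by rewrite abc mul1r subrK mulr1.
Qed.

(** Weighted means with weights 1/p + 1/q - 1, 1 - 1/q, 1 - 1/p, applied to
x^q y^p / c, y^p and x^q: the exponents of x and of y add up to 1. The free
parameter c plays the part of the optimization in Holder's inequality. *)
Lemma weighted_AMGM_young (R : realType) (p q c x y : R) :
  1 <= p -> 1 <= q -> 0 <= p^-1 + q^-1 - 1 -> 0 < c -> 0 <= x -> 0 <= y ->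
  x * y <= c `^ (p^-1 + q^-1 - 1) *
    ((p^-1 + q^-1 - 1) / c * (x `^ q * y `^ p) +
     (1 - q^-1) * y `^ p + (1 - p^-1) * x `^ q).
Proof.
move=> p1 q1; set a := p^-1 + q^-1 - 1 => a0 c0.
have p0 : 0 < p := lt_le_trans ltr01 p1; have q0 : 0 < q := lt_le_trans ltr01 q1.
have b0 : 0 <= 1 - q^-1 by rewrite subr_ge0 invf_le1.
have d0 : 0 <= 1 - p^-1 by rewrite subr_ge0 invf_le1.
have rhs0 : 0 <= c `^ a * (a / c * (x `^ q * y `^ p) +
     (1 - q^-1) * y `^ p + (1 - p^-1) * x `^ q).
  rewrite mulr_ge0 ?powR_ge0// !addr_ge0 ?mulr_ge0 ?powR_ge0//.
  by rewrite invr_ge0 ltW.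
rewrite le_eqVlt => /predU1P[x0|x0]; first by rewrite -[X in X * _]x0 mul0r.
rewrite le_eqVlt => /predU1P[y0|y0]; first by rewrite -[X in _ * X]y0 mulr0.
have pow0 t r : 0 < t -> 0 < t `^ r :> R by exact: powR_gt0.
have u0 : 0 < c^-1 * (x `^ q * y `^ p) by rewrite !mulr_gt0 ?invr_gt0 ?pow0.
have abc : a + (1 - q^-1) + (1 - p^-1) = 1 by rewrite /a; ring.
have := weighted_AMGM3 a0 b0 d0 abc u0 (pow0 _ p y0) (pow0 _ q x0).
rewrite [a * (c^-1 * _)]mulrA => AM.
rewrite -ler_pdivrMl ?pow0//; apply: le_trans AM.
rewrite mulrA le_eqVlt; apply/orP; left; apply/eqP.
rewrite powRM ?invr_ge0 ?mulr_ge0 ?ltW// ?pow0// powRM ?ltW ?pow0//.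
rewrite -!powRrM [c^-1 `^ a](_ : _ = (c `^ a)^-1); last first.
  by rewrite -powR_inv1 ?ltW// -powRrM mulN1r powRN.
rewrite -!mulrA; congr (_ * _).
have cmb t u v : 0 < t -> t `^ u * t `^ v = t `^ (u + v) :> R.
  by move=> t0; rewrite powRD// (gt_eqF t0) implybT.
rewrite [RHS](_ : _ = (x `^ (q * a) * x `^ (q * (1 - p^-1))) *
   (y `^ (p * a) * y `^ (p * (1 - q^-1)))); last by ring.
rewrite !cmb// -!mulrDr.
have -> : q * (a + (1 - p^-1)) = 1 by rewrite /a; field; rewrite !gt_eqF.
have -> : p * (a + (1 - q^-1)) = 1 by rewrite /a; field; rewrite !gt_eqF.
by rewrite !powRr1// ltW.
Qed.

(** This passes from bounds by every x > t to a bound by t itself, so that norms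
may be replaced by larger positive numbers and the case of norm zero needs no
separate treatment. *)
Lemma le_mul_of_gt (R : realType) (N : \bar R) (c t : R) : 0 <= c ->
  (forall x, t < x -> (N <= (c * x)%:E)%E) -> (N <= (c * t)%:E)%E.
Proof.
rewrite le_eqVlt => /predU1P[<-|c0] H.
  by apply: le_trans (H (t + 1) _) _; rewrite ?ltrDl// !mul0r.
apply/lee_addgt0Pr => e e0.
apply: le_trans (H (t + e / c) _) _; first by rewrite ltrDl divr_gt0.
by rewrite -EFinD lee_fin mulrDr mulrCA mulfV ?mulr1// gt_eqF.
Qed.

Section YoungKernel.
Context d (T : measurableType d) {R : realType}.
Variable mu : {sigma_finite_measure set T -> \bar R}.
Variables (rho : T -> R) (M : T -> T -> T -> R) (C : R).
Hypothesis rho0 : forall x, 0 <= rho x.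
Hypothesis mrho : measurable_fun setT rho.
Hypothesis M0 : forall w v k, 0 <= M w v k.
Hypothesis mM : measurable_fun setT (fun x : T * (T * T) => M x.1 x.2.1 x.2.2).
Hypothesis C0 : 0 < C.
Hypothesis massw : forall v k, (\int[mu]_w (M w v k * rho w)%:E <= C%:E)%E.
Hypothesis massv : forall w k, (\int[mu]_v (M w v k * rho v)%:E <= C%:E)%E.
Hypothesis massk : forall w v, (\int[mu]_k (M w v k * rho k)%:E <= C%:E)%E.

Local Notation mu2 := (mu \x mu)%E.

(** A function H of the pair (v, k) is integrated against the kernel M w. Young's
inequality concerns H = G(v) F(k), but the proof also needs the powers
G(v)^q F(k)^p, F(k)^p and G(v)^q; linearity in H then does the work of a
three-factor Holder inequality. *)
Definition kernel_int (H : T * T -> R) (w : T) : \bar R :=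
  (\int[mu2]_z (H z * (M w z.1 z.2 * (rho z.1 * rho z.2)))%:E)%E.

Lemma measurable_rho d' (X : measurableType d') (f : X -> T) :
  measurable_fun setT f -> measurable_fun setT (fun x => rho (f x)).
Proof. by move=> mf; exact: (measurableT_comp mrho). Qed.

Lemma measurable_M d' (X : measurableType d') (f g h : X -> T) :
  measurable_fun setT f -> measurable_fun setT g -> measurable_fun setT h ->
  measurable_fun setT (fun x => M (f x) (g x) (h x)).
Proof.
move=> mf mg mh.
exact: (measurableT_comp mM (measurable_fun_pair mf (measurable_fun_pair mg mh))).
Qed.

Ltac measK := meas; lazymatch goal with
  | |- measurable_fun _ (fun x => M _ _ _) => apply: measurable_M; measK
  | |- measurable_fun _ (M _ _) =>
      apply: measurable_M; [exact: measurable_cst|exact: measurable_cst|exact: measurable_id]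
  | |- measurable_fun _ (fun x => rho _) => apply: measurable_rho; measK
  | _ => idtac
  end.

Lemma kernel_int_ge0 H w : (forall z, 0 <= H z) -> (0 <= kernel_int H w)%E.
Proof.
by move=> H0; apply: integral_ge0 => z _; rewrite lee_fin !mulr_ge0.
Qed.

Let mker (H : T * T -> R) w : measurable_fun setT H ->
  measurable_fun setT (fun z : T * T => (H z * (M w z.1 z.2 * (rho z.1 * rho z.2)))%:E).
Proof. by move=> mH; measK. Qed.

Lemma measurable_kernel_int (H : T * T -> R) : measurable_fun setT H ->
  (forall z, 0 <= H z) -> measurable_fun setT (kernel_int H).
Proof.
move=> mH H0.
pose f (x : T * T * T) : \bar R :=
  (H (x.1.2, x.2) * (M x.1.1 x.1.2 x.2 * (rho x.1.2 * rho x.2)))%:E.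
have f0 x : (0 <= f x)%E by rewrite lee_fin !mulr_ge0.
have mf : measurable_fun setT f by rewrite /f; measK.
have -> : kernel_int H = fun w => (\int[mu]_v \int[mu]_k f ((w, v), k))%E.
  apply/funext => w; rewrite /kernel_int fubini_tonelli1//; first exact: mker.
  by move=> z; rewrite lee_fin !mulr_ge0.
apply: (@measurable_fun_fubini_tonelli_F _ _ T T R mu (fubini_F mu f)).
  exact: measurable_fun_fubini_tonelli_F.
by move=> x; exact: integral_ge0.
Qed.

Lemma le_kernel_int (H H' : T * T -> R) w :
  measurable_fun setT H -> measurable_fun setT H' ->
  (forall z, 0 <= H z) -> (forall z, H z <= H' z) ->
  (kernel_int H w <= kernel_int H' w)%E.
Proof.
move=> mH mH' H0 HH'; apply: ge0_le_integral => //.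
- by move=> z _; rewrite lee_fin !mulr_ge0.
- exact: mker.
- exact: mker.
- by move=> z _; rewrite lee_fin ler_wpM2r// !mulr_ge0.
Qed.

Lemma kernel_intZ c (H : T * T -> R) w : 0 <= c ->
  measurable_fun setT H -> (forall z, 0 <= H z) ->
  kernel_int (fun z => c * H z) w = (c%:E * kernel_int H w)%E.
Proof.
move=> c0 mH H0; rewrite /kernel_int.
under eq_integral do rewrite -mulrA EFinM.
rewrite ge0_integralZl//; first exact: mker.
by move=> z _; rewrite lee_fin !mulr_ge0.
Qed.

Lemma kernel_intD (H H' : T * T -> R) w :
  measurable_fun setT H -> (forall z, 0 <= H z) ->
  measurable_fun setT H' -> (forall z, 0 <= H' z) ->
  kernel_int (fun z => H z + H' z) w = (kernel_int H w + kernel_int H' w)%E.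
Proof.
move=> mH H0 mH' H0'; rewrite /kernel_int.
under eq_integral do rewrite mulrDl EFinD.
rewrite ge0_integralD//.
- by move=> z _; rewrite lee_fin !mulr_ge0.
- exact: mker.
- by move=> z _; rewrite lee_fin !mulr_ge0.
- exact: mker.
Qed.

Lemma kernel_int_iter (F G : T -> R) w :
  measurable_fun setT F -> (forall x, 0 <= F x) ->
  measurable_fun setT G -> (forall x, 0 <= G x) ->
  kernel_int (fun z => (G z.1 * F z.2)%R) w =
  (\int[mu]_v ((G v * rho v)%:E * \int[mu]_k (F k * (M w v k * rho k))%:E))%E.
Proof.
move=> mF F0 mG G0; rewrite /kernel_int fubini_tonelli1; last 2 first.
- by measK.
- by move=> z; rewrite lee_fin !mulr_ge0.
apply: eq_integral => v _; rewrite /fubini_F -ge0_integralZl//; last 3 first.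
- by measK.
- by move=> k _; rewrite lee_fin !mulr_ge0.
- by rewrite lee_fin mulr_ge0.
by apply: eq_integral => k _ /=; rewrite -EFinM; congr EFin; ring.
Qed.

Lemma kernel_int_iter_swap (F G : T -> R) w :
  measurable_fun setT F -> (forall x, 0 <= F x) ->
  measurable_fun setT G -> (forall x, 0 <= G x) ->
  kernel_int (fun z => (G z.1 * F z.2)%R) w =
  (\int[mu]_k ((F k * rho k)%:E * \int[mu]_v (G v * (M w v k * rho v))%:E))%E.
Proof.
move=> mF F0 mG G0; rewrite /kernel_int fubini_tonelli2; last 2 first.
- by measK.
- by move=> z; rewrite lee_fin !mulr_ge0.
apply: eq_integral => k _; rewrite /fubini_G -ge0_integralZl//; last 3 first.
- by measK.
- by move=> v _; rewrite lee_fin !mulr_ge0.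
- by rewrite lee_fin mulr_ge0.
by apply: eq_integral => v _ /=; rewrite -EFinM; congr EFin; ring.
Qed.

Lemma measurable_inner_k (F : T -> R) w :
  measurable_fun setT F -> (forall x, 0 <= F x) ->
  measurable_fun setT (fun v => (\int[mu]_k (F k * (M w v k * rho k))%:E)%E).
Proof.
move=> mF F0; apply: (@measurable_fun_fubini_tonelli_F _ _ T T R mu
  (fun x : T * T => (F x.2 * (M w x.1 x.2 * rho x.2))%:E)); first by measK.
by move=> x; rewrite lee_fin !mulr_ge0.
Qed.

Lemma measurable_inner_v (G : T -> R) w :
  measurable_fun setT G -> (forall x, 0 <= G x) ->
  measurable_fun setT (fun k => (\int[mu]_v (G v * (M w v k * rho v))%:E)%E).
Proof.
move=> mG G0; apply: (@measurable_fun_fubini_tonelli_F _ _ T T R mu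
  (fun x : T * T => (G x.2 * (M w x.2 x.1 * rho x.2))%:E)); first by measK.
by move=> x; rewrite lee_fin !mulr_ge0.
Qed.

Lemma kernel_int_le_fst (F G : T -> R) w :
  measurable_fun setT F -> (forall x, 0 <= F x) ->
  measurable_fun setT G -> (forall x, 0 <= G x) ->
  (\forall x \ae mu, F x <= 1) ->
  (kernel_int (fun z => (G z.1 * F z.2)%R) w <= C%:E * \int[mu]_v (G v * rho v)%:E)%E.
Proof.
move=> mF F0 mG G0 F1; rewrite kernel_int_iter// -ge0_integralZl//; last 3 first.
- by measK.
- by move=> v _; rewrite lee_fin mulr_ge0.
- by rewrite lee_fin ltW.
apply: ge0_le_integral => //.
- move=> v _; rewrite mule_ge0 ?lee_fin ?mulr_ge0//.
  by apply: integral_ge0 => k _; rewrite lee_fin !mulr_ge0.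
- by apply: measurable_emul; [measK|exact: measurable_inner_k].
- by measK.
- move=> v _; rewrite muleC; apply: lee_wpmul2r; first by rewrite lee_fin mulr_ge0.
  apply: le_trans (massk w v); apply: ae_ge0_le_integral => //.
  + by move=> k _; rewrite lee_fin !mulr_ge0.
  + by measK.
  + by move=> k _; rewrite lee_fin !mulr_ge0.
  + by measK.
  + apply: filterS F1 => k Fk _; rewrite lee_fin ler_piMl// mulr_ge0//.
Qed.

Lemma kernel_int_le_snd (F G : T -> R) w :
  measurable_fun setT F -> (forall x, 0 <= F x) ->
  measurable_fun setT G -> (forall x, 0 <= G x) ->
  (\forall x \ae mu, G x <= 1) ->
  (kernel_int (fun z => (G z.1 * F z.2)%R) w <= C%:E * \int[mu]_k (F k * rho k)%:E)%E.
Proof.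
move=> mF F0 mG G0 G1; rewrite kernel_int_iter_swap// -ge0_integralZl//; last 3 first.
- by measK.
- by move=> v _; rewrite lee_fin mulr_ge0.
- by rewrite lee_fin ltW.
apply: ge0_le_integral => //.
- move=> v _; rewrite mule_ge0 ?lee_fin ?mulr_ge0//.
  by apply: integral_ge0 => k _; rewrite lee_fin !mulr_ge0.
- by apply: measurable_emul; [measK|exact: measurable_inner_v].
- by measK.
- move=> k _; rewrite muleC; apply: lee_wpmul2r; first by rewrite lee_fin mulr_ge0.
  apply: le_trans (massv w k); apply: ae_ge0_le_integral => //.
  + by move=> v _; rewrite lee_fin !mulr_ge0.
  + by measK.
  + by move=> v _; rewrite lee_fin !mulr_ge0.
  + by measK.
  + apply: filterS G1 => v Gv _; rewrite lee_fin ler_piMl// mulr_ge0//.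
Qed.

(** Integration in w first, by Tonelli, costs the factor C and leaves a product. *)
Lemma kernel_int_mass (F G : T -> R) :
  measurable_fun setT F -> (forall x, 0 <= F x) ->
  measurable_fun setT G -> (forall x, 0 <= G x) ->
  (\int[mu]_w (kernel_int (fun z => (G z.1 * F z.2)%R) w * (rho w)%:E) <=
   C%:E * (\int[mu]_v (G v * rho v)%:E * \int[mu]_k (F k * rho k)%:E))%E.
Proof.
move=> mF F0 mG G0.
pose h (x : T * T * T) : \bar R :=
  (G x.1.2 * F x.2 * (M x.1.1 x.1.2 x.2 * (rho x.1.2 * rho x.2)) * rho x.1.1)%:E.
have mh : measurable_fun setT h by rewrite /h; measK.
have h0 x : (0 <= h x)%E by rewrite lee_fin !mulr_ge0.
have -> : (\int[mu]_w (kernel_int (fun z => (G z.1 * F z.2)%R) w * (rho w)%:E) =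
    \int[mu]_w \int[mu]_v fubini_F mu h (w, v))%E.
  apply: eq_integral => w _; rewrite /kernel_int -ge0_integralZr//; last 3 first.
  - by apply: mker; measK.
  - by move=> z _; rewrite lee_fin !mulr_ge0.
  - by rewrite lee_fin.
  rewrite fubini_tonelli1//; first by measK.
  by move=> z; rewrite -EFinM lee_fin !mulr_ge0.
rewrite (@fubini_tonelli _ _ _ _ _ mu mu (fubini_F mu h)); last 2 first.
- exact: measurable_fun_fubini_tonelli_F.
- by move=> x; exact: integral_ge0.
have inner v k : (\int[mu]_w h ((w, v), k) <= C%:E * (G v * rho v)%:E * (F k * rho k)%:E)%E.
  have -> : (\int[mu]_w h ((w, v), k) = (G v * rho v * (F k * rho k))%:E *
     \int[mu]_w (M w v k * rho w)%:E)%E.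
    rewrite -ge0_integralZl//.
    + by apply: eq_integral => w _; rewrite /h /= -EFinM; congr EFin; ring.
    + by measK.
    + by move=> w _; rewrite lee_fin mulr_ge0.
    + by rewrite lee_fin !mulr_ge0.
  rewrite -muleA -EFinM muleC [leRHS]EFinM; apply: lee_wpmul2r; first by rewrite lee_fin !mulr_ge0.
  exact: massw.
rewrite -ge0_integralZr//; last 3 first.
- by measK.
- by move=> v _; rewrite lee_fin mulr_ge0.
- by apply: integral_ge0 => k _; rewrite lee_fin mulr_ge0.
rewrite -ge0_integralZl//; last 3 first.
- by measK.
- move=> v _; rewrite mule_ge0 ?lee_fin ?mulr_ge0//.
  by apply: integral_ge0 => k _; rewrite lee_fin mulr_ge0.
- by rewrite lee_fin ltW.
have mhv v : measurable_fun setT (fun x : T * T => h ((x.1, v), x.2)).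
  by rewrite /h /=; measK.
apply: ge0_le_integral => //.
- by move=> v _; apply: integral_ge0 => w _; exact: integral_ge0.
- apply: (@measurable_fun_fubini_tonelli_G _ _ T T R mu (fubini_F mu h)).
    exact: measurable_fun_fubini_tonelli_F.
  by move=> x; exact: integral_ge0.
- by measK.
move=> v _; rewrite /fubini_F /=.
rewrite (@fubini_tonelli _ _ _ _ _ mu mu (fun x : T * T => h ((x.1, v), x.2)))//.
rewrite muleA -ge0_integralZl//; last 3 first.
- by measK.
- by move=> k _; rewrite lee_fin mulr_ge0.
- by rewrite -EFinM lee_fin !mulr_ge0// ltW.
apply: ge0_le_integral => //.
- by move=> k _; exact: integral_ge0.
- exact: (@measurable_fun_fubini_tonelli_G _ _ T T R mu (fun x : T * T => h ((x.1, v), x.2))).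
- by measK.
- by move=> k _; exact: inner.
Qed.

Section Exponents.
Variables (p q : R).
Hypotheses (p1 : 1 <= p) (q1 : 1 <= q).
Local Notation a := (p^-1 + q^-1 - 1).
Hypothesis a0 : 0 <= a.
Variables (F G : T -> R).
Hypotheses (mF : measurable_fun setT F) (F0 : forall x, 0 <= F x).
Hypotheses (mG : measurable_fun setT G) (G0 : forall x, 0 <= G x).
Hypothesis IF : (\int[mu]_x (F x `^ p * rho x)%:E <= 1)%E.
Hypothesis IG : (\int[mu]_x (G x `^ q * rho x)%:E <= 1)%E.

(** AM-GM with parameter s / C, integrated against the kernel: the terms in F^p
alone and G^q alone have integral at most C, and the mixed term at most s, so the
weighted sum is at most C. The disjunction is there because the mixed term,
whose weight is 1/p + 1/q - 1, has weight 0 when 1/p + 1/q = 1. *)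
Lemma kernel_int_le (s : R) w : 0 < s ->
  a = 0 \/ (kernel_int (fun z => (G z.1 `^ q * F z.2 `^ p)%R) w <= s%:E)%E ->
  (kernel_int (fun z => (G z.1 * F z.2)%R) w <= ((s / C) `^ a * C)%:E)%E.
Proof.
move=> s0 Hs; have c0 : 0 < s / C by rewrite divr_gt0.
have p0 : 0 < p := lt_le_trans ltr01 p1; have q0 : 0 < q := lt_le_trans ltr01 q1.
have b0 : 0 <= 1 - q^-1 by rewrite subr_ge0 invf_le1.
have d0 : 0 <= 1 - p^-1 by rewrite subr_ge0 invf_le1.
have ac0 : 0 <= a / (s / C) by rewrite divr_ge0// ltW.
pose H1 (z : T * T) := G z.1 `^ q * F z.2 `^ p.
pose H2 (z : T * T) := F z.2 `^ p.
pose H3 (z : T * T) := G z.1 `^ q.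
have mFp : measurable_fun setT (fun x => F x `^ p) by measK.
have mGq : measurable_fun setT (fun x => G x `^ q) by measK.
have mH1 : measurable_fun setT H1 by rewrite /H1; measK.
have mH2 : measurable_fun setT H2 by rewrite /H2; measK.
have mH3 : measurable_fun setT H3 by rewrite /H3; measK.
have H10 z : 0 <= H1 z by rewrite mulr_ge0 ?powR_ge0.
have H20 z : 0 <= H2 z by rewrite powR_ge0.
have H30 z : 0 <= H3 z by rewrite powR_ge0.
have K2 : (kernel_int H2 w <= C%:E)%E.
  have -> : H2 = fun z => (1 * F z.2 `^ p)%R by apply/funext => z; rewrite mul1r.
  apply: (@le_trans _ _ (C%:E * \int[mu]_k (F k `^ p * rho k)%:E)%E).
    apply: (@kernel_int_le_snd (fun x => F x `^ p) (fun=> 1)) => //.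
    - by move=> x; exact: powR_ge0.
    - by apply: nearW.
  by rewrite -[leRHS]mule1; apply: lee_wpmul2l => //; rewrite lee_fin ltW.
have K3 : (kernel_int H3 w <= C%:E)%E.
  have -> : H3 = fun z => (G z.1 `^ q * 1)%R by apply/funext => z; rewrite mulr1.
  apply: (@le_trans _ _ (C%:E * \int[mu]_k (G k `^ q * rho k)%:E)%E).
    apply: (@kernel_int_le_fst (fun=> 1) (fun x => G x `^ q)) => //.
    - by move=> x; exact: powR_ge0.
    - by apply: nearW.
  by rewrite -[leRHS]mule1; apply: lee_wpmul2l => //; rewrite lee_fin ltW.
have K1 : ((a / (s / C))%:E * kernel_int H1 w <= (a * C)%:E)%E.
  case: Hs => [->|Hs]; first by rewrite mul0r mul0e mul0r.
  apply: (@le_trans _ _ ((a / (s / C))%:E * s%:E)%E).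
    by apply: lee_wpmul2l => //; rewrite lee_fin.
  by rewrite -EFinM lee_fin le_eqVlt; apply/orP; left; apply/eqP; field; rewrite !gt_eqF.
pose H z := (s / C) `^ a * (a / (s / C) * H1 z + (1 - q^-1) * H2 z + (1 - p^-1) * H3 z).
apply: (@le_trans _ _ (kernel_int H w)).
  apply: le_kernel_int.
  - by measK.
  - by rewrite /H; measK.
  - by move=> z; rewrite mulr_ge0.
  - by move=> z; exact: weighted_AMGM_young.
rewrite /H kernel_intZ ?powR_ge0//; last 2 first.
- by measK.
- by move=> z; rewrite !addr_ge0// mulr_ge0.
rewrite kernel_intD; [|measK|by move=> z; rewrite !addr_ge0// mulr_ge0|measK
  |by move=> z; rewrite mulr_ge0].
rewrite kernel_intD; [|measK|by move=> z; rewrite mulr_ge0|measK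
  |by move=> z; rewrite mulr_ge0].
rewrite !kernel_intZ// [leRHS]EFinM; apply: lee_wpmul2l; first by rewrite lee_fin powR_ge0.
rewrite [X in (_ <= X%:E)%E](_ : C = a * C + (1 - q^-1) * C + (1 - p^-1) * C); last by ring.
rewrite 2![in leRHS]EFinD; apply: leeD; first apply: leeD => //.
- by rewrite [leRHS]EFinM; apply: lee_wpmul2l => //; rewrite lee_fin.
- by rewrite [leRHS]EFinM; apply: lee_wpmul2l => //; rewrite lee_fin.
Qed.

(** With r = 1/a, the previous bound reads K^r <= C^(r-1) S pointwise, where S is the
integral of G^q F^p against the kernel; S has total mass at most C. *)
Lemma kernel_int_pow_le : 0 < a ->
  (\int[mu]_w (kernel_int (fun z => (G z.1 * F z.2)%R) w `^ a^-1 * (rho w)%:E) <=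
   (C `^ a^-1)%:E)%E.
Proof.
move=> agt0; set r := a^-1; have r0 : 0 < r by rewrite invr_gt0.
have mFp : measurable_fun setT (fun x => F x `^ p) by measK.
have mGq : measurable_fun setT (fun x => G x `^ q) by measK.
pose S := kernel_int (fun z => (G z.1 `^ q * F z.2 `^ p)%R).
have S0 w : (0 <= S w)%E.
  by apply: kernel_int_ge0 => z; rewrite mulr_ge0 ?powR_ge0.
have mS : measurable_fun setT S.
  by apply: measurable_kernel_int; [measK|move=> z; rewrite mulr_ge0 ?powR_ge0].
have K0 w : (0 <= kernel_int (fun z => (G z.1 * F z.2)%R) w)%E.
  by apply: kernel_int_ge0 => z; rewrite mulr_ge0.
have mK : measurable_fun setT (kernel_int (fun z => (G z.1 * F z.2)%R)).
  by apply: measurable_kernel_int; [measK|move=> z; rewrite mulr_ge0].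
have Cr0 : 0 < C `^ (r - 1) by rewrite powR_gt0.
have ptw w : (kernel_int (fun z => (G z.1 * F z.2)%R) w `^ r <= (C `^ (r - 1))%:E * S w)%E.
  have bound s : 0 < s -> (S w <= s%:E)%E ->
      (kernel_int (fun z => (G z.1 * F z.2)%R) w `^ r <= (C `^ (r - 1))%:E * s%:E)%E.
    move=> s0 Ss; have := kernel_int_le s0 (or_intror Ss).
    move=> /(gt0_ler_poweR (ltW r0)) => /(_ _ _)/le_trans; apply.
    - by rewrite in_itv/= K0 leey.
    - by rewrite in_itv/= leey andbT lee_fin mulr_ge0 ?powR_ge0// ltW.
    rewrite poweR_EFin -EFinM lee_fin powRM ?powR_ge0 ?(ltW C0)// -powRrM mulfV ?gt_eqF//.
    rewrite powRr1; last by rewrite divr_ge0 ?ltW.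
    rewrite powRB ?powRr1 ?(ltW C0)//; last by rewrite (gt_eqF C0) implybT.
    by rewrite le_eqVlt; apply/orP; left; apply/eqP; field; rewrite gt_eqF.
  have := S0 w; have := bound; case: (S w) => [s| |]// {}bound s0; last first.
    by rewrite gt0_muley ?lte_fin// leey.
  (* S w may be 0, whereas the parameter s must be positive *)
  apply/lee_addgt0Pr => e e0.
  have e' : 0 < e / C `^ (r - 1) by rewrite divr_gt0.
  apply: le_trans (bound (s + e / C `^ (r - 1)) _ _) _.
  - by rewrite ltr_wpDl.
  - by rewrite lee_fin lerDl ltW.
  rewrite -!EFinM -EFinD lee_fin mulrDr mulrCA mulfV ?mulr1// gt_eqF//.
apply: (@le_trans _ _ (\int[mu]_w ((C `^ (r - 1))%:E * (S w * (rho w)%:E)))%E).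
  apply: ge0_le_integral => //.
  - by move=> w _; rewrite mule_ge0 ?poweR_ge0 ?lee_fin.
  - apply: measurable_emul; last by measK.
    exact: (measurableT_comp (measurable_poweR r)).
  - by measK.
  - move=> w _; rewrite muleA; apply: lee_wpmul2r; first by rewrite lee_fin.
    exact: ptw.
rewrite ge0_integralZl//; last 3 first.
- by measK.
- by move=> w _; rewrite mule_ge0// lee_fin.
- by rewrite lee_fin ltW.
have -> : C `^ r = C `^ (r - 1) * C.
  rewrite powRB ?powRr1 ?(ltW C0)//; last by rewrite (gt_eqF C0) implybT.
  by rewrite divfK// gt_eqF.
rewrite EFinM; apply: lee_wpmul2l; first by rewrite lee_fin ltW.
apply: (le_trans (kernel_int_mass mFp _ mGq _)).
- by move=> x; exact: powR_ge0.
- by move=> x; exact: powR_ge0.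
rewrite -[leRHS]mule1; apply: lee_wpmul2l; first by rewrite lee_fin ltW.
rewrite -[leRHS]mule1; apply: lee_pmul => //.
- by apply: integral_ge0 => x _; rewrite lee_fin mulr_ge0 ?powR_ge0.
- by apply: integral_ge0 => x _; rewrite lee_fin mulr_ge0 ?powR_ge0.
Qed.

End Exponents.

Hypothesis muT : (0 < mu setT)%E.

(** The L^p norm for the measure rho dmu, for values in [0, +oo]: the bound
[kernel_int] of a convolution may be infinite at some points. For p = +oo the
essential supremum refers to mu, as in [dunkl_norm]. *)
Definition wnorm (p : \bar R) (H : T -> \bar R) : \bar R :=
  match p with
  | p'%:E => ((\int[mu]_x (H x `^ p' * (rho x)%:E)) `^ p'^-1)%E
  | +oo%E => ess_sup mu H
  | -oo%E => 0%E
  end.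

Lemma wnorm_ge0 p H : (forall x, 0 <= H x)%E -> (0 <= wnorm p H)%E.
Proof.
move=> H0; case: p => [p| |]//=; first exact: poweR_ge0.
by apply: ess_sup_gee => //; exact: nearW.
Qed.

Lemma wnormZ p c H : (1 <= p)%E -> 0 < c -> measurable_fun setT H ->
  (forall x, 0 <= H x)%E ->
  wnorm p (fun x => (c%:E * H x)%E) = (c%:E * wnorm p H)%E.
Proof.
case: p => [p| |]//= p1 c0 mH H0; last exact: ess_sup_pZl.
have p0 : 0 < p by rewrite lee_fin in p1; exact: lt_le_trans p1.
under eq_integral do rewrite poweRM ?lee_fin ?(ltW c0)// poweR_EFin -muleA.
rewrite ge0_integralZl//; last 3 first.
- apply: measurable_emul; last by measK.
  exact: (measurableT_comp (measurable_poweR p)).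
- by move=> x _; rewrite mule_ge0 ?poweR_ge0 ?lee_fin.
- by rewrite lee_fin powR_ge0.
rewrite poweRM ?lee_fin ?powR_ge0//; last first.
  by apply: integral_ge0 => x _; rewrite mule_ge0 ?poweR_ge0 ?lee_fin.
by rewrite poweR_EFin -powRrM mulfV ?gt_eqF// powRr1// ltW.
Qed.

Lemma wnorm_le1 p (F : T -> R) : 0 < p ->
  (wnorm p%:E (EFin \o F) <= 1)%E -> (\int[mu]_x (F x `^ p * rho x)%:E <= 1)%E.
Proof.
move=> p0 /= H.
have I0 : (0 <= \int[mu]_x (F x `^ p * rho x)%:E)%E.
  by apply: integral_ge0 => x _; rewrite lee_fin mulr_ge0 ?powR_ge0.
have {}H : ((\int[mu]_x (F x `^ p * rho x)%:E) `^ p^-1 <= 1)%E.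
  by under eq_integral do rewrite EFinM.
have := @gt0_ler_poweR R p (ltW p0) _ _ _ _ H.
rewrite -poweRrM mulVf ?gt_eqF// poweRe1// poweR1r; apply.
- by rewrite in_itv/= poweR_ge0 leey.
- by rewrite in_itv/= leey lee_fin ler01.
Qed.

(** If p or q is infinite, the relation between the exponents forces r = +oo and
the other exponent to be 1; then one factor is at most 1 almost everywhere. If
p and q are finite, r = +oo is the case of weight 0 in AM-GM, and r finite is the
integrated power bound. *)
Lemma young_unit (p q r : \bar R) (F G : T -> R) :
  (1 <= p)%E -> (1 <= q)%E -> (1 <= r)%E -> (p^-1 + q^-1 = r^-1 + 1)%E ->
  measurable_fun setT F -> (forall x, 0 <= F x) ->
  measurable_fun setT G -> (forall x, 0 <= G x) ->
  (wnorm p (EFin \o F) <= 1)%E -> (wnorm q (EFin \o G) <= 1)%E ->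
  (wnorm r (kernel_int (fun z => (G z.1 * F z.2)%R)) <= C%:E)%E.
Proof.
move=> p1 q1 r1 pqr mF F0 mG G0 nF nG.
have inv_bnd (t : R) : (1 <= t%:E)%E ->
    [/\ (t%:E^-1 = t^-1%:E)%E, 0 < t, 0 < t^-1 & t^-1 <= 1].
  rewrite lee_fin => t1; have t0 : 0 < t := lt_le_trans ltr01 t1.
  by rewrite inver gt_eqF// invr_gt0 t0 invf_le1.
have int1 (H : T -> R) : (forall x, 0 <= H x) ->
    (wnorm 1%:E (EFin \o H) <= 1)%E -> (C%:E * \int[mu]_x (H x * rho x)%:E <= C%:E)%E.
  move=> H0 /(wnorm_le1 ltr01); under eq_integral do rewrite powRr1//.
  by move=> Hle; rewrite -[leRHS]mule1; apply: lee_wpmul2l => //; rewrite lee_fin ltW.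
case: p p1 pqr nF => [p| |]// p1 pqr nF; last first.
  case: q q1 pqr nG => [q| |]// q1 pqr nG; last first.
    move: pqr; rewrite invey add0e; case: r r1 => [r| |]// r1.
    - have [-> _ r0 _] := inv_bnd _ r1; rewrite -EFinD => -[] /esym/eqP.
      by rewrite gt_eqF// addr_gt0.
    - by rewrite invey add0e => -[] /esym/eqP; rewrite oner_eq0.
  move: pqr; have [qE q0 qi qi1] := inv_bnd _ q1; rewrite qE invey add0e.
  case: r r1 => [r| |]// r1.
    have [-> _ r0 _] := inv_bnd _ r1; rewrite -EFinD => -[qr].
    by move: qi1; rewrite qr gerDr leNgt r0.
  rewrite invey add0e => -[] /(congr1 GRing.inv); rewrite invrK invr1 => q11.
  apply/ess_supP; apply: nearW => w.
  apply: le_trans (int1 G G0 _); last by move: nG; rewrite q11.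
  apply: kernel_int_le_fst => //.
  by move/ess_supP : nF; apply: filterS => x; rewrite /= lee_fin.
have [pE p0 pi pi1] := inv_bnd _ p1.
case: q q1 pqr nG => [q| |]// q1 pqr nG; last first.
  move: pqr; rewrite pE invey adde0; case: r r1 => [r| |]// r1.
    have [-> _ r0 _] := inv_bnd _ r1; rewrite -EFinD => -[pr].
    by move: pi1; rewrite pr gerDr leNgt r0.
  rewrite invey add0e => -[] /(congr1 GRing.inv); rewrite invrK invr1 => p11.
  apply/ess_supP; apply: nearW => w.
  apply: le_trans (int1 F F0 _); last by move: nF; rewrite p11.
  apply: kernel_int_le_snd => //.
  by move/ess_supP : nG; apply: filterS => x; rewrite /= lee_fin.
have [qE q0 qi qi1] := inv_bnd _ q1.
have {}nF := wnorm_le1 p0 nF; have {}nG := wnorm_le1 q0 nG.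
rewrite !lee_fin in p1 q1.
move: pqr; rewrite pE qE; case: r r1 => [r| |]// r1; last first.
  rewrite invey add0e -EFinD => -[] pq.
  have a0 : p^-1 + q^-1 - 1 = 0 by rewrite pq subrr.
  apply/ess_supP; apply: nearW => w.
  have a0' : 0 <= p^-1 + q^-1 - 1 by rewrite a0.
  have := @kernel_int_le p q p1 q1 a0' F G mF F0 mG G0 nF nG C w C0 (or_introl a0).
  by rewrite a0 powRr0 mul1r.
have [-> r0 ri _] := inv_bnd _ r1; rewrite -!EFinD => -[] pq.
have aE : p^-1 + q^-1 - 1 = r^-1 by rewrite pq addrK.
have agt : 0 < p^-1 + q^-1 - 1 by rewrite aE.
have := @kernel_int_pow_le p q p1 q1 (ltW agt) F G mF F0 mG G0 nF nG agt.
rewrite aE invrK => le /=.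
have := @gt0_ler_poweR R r^-1 (ltW ri) _ _ _ _ le.
rewrite poweR_EFin -powRrM mulfV ?gt_eqF// powRr1 ?(ltW C0)//; apply.
- rewrite in_itv/= leey andbT; apply: integral_ge0 => x _.
  by rewrite mule_ge0 ?poweR_ge0 ?lee_fin.
- by rewrite in_itv/= leey lee_fin powR_ge0.
Qed.

(** Young's inequality for a kernel whose three marginals are at most C: the norms
of F and G are scaled to at most 1 by any x and y above them. *)
Lemma kernel_young (p q r : \bar R) (F G : T -> R) :
  (1 <= p)%E -> (1 <= q)%E -> (1 <= r)%E -> (p^-1 + q^-1 = r^-1 + 1)%E ->
  measurable_fun setT F -> (forall x, 0 <= F x) ->
  measurable_fun setT G -> (forall x, 0 <= G x) ->
  (wnorm p (EFin \o F) < +oo)%E -> (wnorm q (EFin \o G) < +oo)%E ->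
  (wnorm r (kernel_int (fun z => (G z.1 * F z.2)%R)) <=
   C%:E * wnorm p (EFin \o F) * wnorm q (EFin \o G))%E.
Proof.
move=> p1 q1 r1 pqr mF F0 mG G0.
have unit (s : \bar R) (H : T -> R) (x : R) : (1 <= s)%E -> measurable_fun setT H ->
    (forall t, 0 <= H t) -> 0 < x -> (wnorm s (EFin \o H) < x%:E)%E ->
    (wnorm s (EFin \o (fun t => x^-1 * H t)%R) <= 1)%E.
  move=> s1 mH H0 x0 Hx.
  rewrite (_ : EFin \o _ = fun t => (x^-1%:E * (H t)%:E)%E); last exact/funext.
  rewrite wnormZ ?invr_gt0//; last exact: measurable_EFin.
  by rewrite lee_pdivrMl// mule1 ltW.
have key x y : (wnorm p (EFin \o F) < x%:E)%E -> (wnorm q (EFin \o G) < y%:E)%E ->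
    (wnorm r (kernel_int (fun z => (G z.1 * F z.2)%R)) <= (C * x * y)%:E)%E.
  move=> Fx Gy.
  have x0 : 0 < x by rewrite -lte_fin; apply: le_lt_trans Fx; exact: wnorm_ge0.
  have y0 : 0 < y by rewrite -lte_fin; apply: le_lt_trans Gy; exact: wnorm_ge0.
  have mF' : measurable_fun setT (fun t => x^-1 * F t) by measK.
  have mG' : measurable_fun setT (fun t => y^-1 * G t) by measK.
  have F0' t : 0 <= x^-1 * F t by rewrite mulr_ge0// invr_ge0 ltW.
  have G0' t : 0 <= y^-1 * G t by rewrite mulr_ge0// invr_ge0 ltW.
  have := young_unit p1 q1 r1 pqr mF' F0' mG' G0' (unit _ _ _ p1 mF F0 x0 Fx)
    (unit _ _ _ q1 mG G0 y0 Gy).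
  have xy0 : 0 < x * y by rewrite mulr_gt0.
  have -> : kernel_int (fun z => (G z.1 * F z.2)%R) = (fun w => (x * y)%:E *
      kernel_int (fun z => (y^-1 * G z.1 * (x^-1 * F z.2))%R) w)%E.
    apply/funext => w; rewrite -kernel_intZ ?ltW//; last 2 first.
    - by measK.
    - by move=> z; rewrite mulr_ge0.
    congr (kernel_int _ w); apply/funext => z; field; rewrite !gt_eqF//.
  move=> le; rewrite wnormZ//; last 2 first.
  - by apply: measurable_kernel_int; [measK|move=> z; rewrite mulr_ge0].
  - by move=> w; apply: kernel_int_ge0 => z; rewrite mulr_ge0.
  rewrite -mulrA (mulrC C) [leRHS]EFinM; apply: lee_wpmul2l => //.
  by rewrite lee_fin ltW.
have := @wnorm_ge0 p (EFin \o F) F0; have := @wnorm_ge0 q (EFin \o G) G0.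
move: key; case: (wnorm p _) => [s| |]//; case: (wnorm q _) => [t| |]// key.
rewrite !lee_fin => t0 s0 _ _; rewrite -!EFinM.
apply: le_mul_of_gt; first by rewrite mulr_ge0// ltW.
move=> y ty; rewrite mulrAC; apply: le_mul_of_gt.
  by rewrite mulr_ge0 ?ltW// (le_lt_trans t0).
by move=> x sx; rewrite mulrAC; apply: key; rewrite lte_fin.
Qed.

Lemma wnorm_lty_ae (r : \bar R) (H : T -> \bar R) : (1 <= r)%E ->
  measurable_fun setT H -> (forall x, 0 <= H x)%E ->
  (\forall x \ae mu, 0 < rho x) -> (wnorm r H < +oo)%E ->
  \forall x \ae mu, (H x < +oo)%E.
Proof.
case: r => [r| |]//= r1 mH H0 rho_gt0 fin; last first.
  by apply: filterS (ess_sup_ge mu H) => x /le_lt_trans; apply.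
have r0 : 0 < r by rewrite lee_fin in r1; exact: lt_le_trans r1.
have mI : measurable_fun setT (fun x => (H x `^ r * (rho x)%:E)%E).
  apply: measurable_emul; last by measK.
  exact: (measurableT_comp (measurable_poweR r)).
have I0 x : (0 <= H x `^ r * (rho x)%:E)%E by rewrite mule_ge0 ?poweR_ge0 ?lee_fin.
have Iint : mu.-integrable setT (fun x => (H x `^ r * (rho x)%:E)%E).
  apply/integrableP; split=> //; under eq_integral do rewrite gee0_abs//.
  by apply: lty_poweRy fin; rewrite invr_eq0 gt_eqF.
apply: filterS2 (integrable_ae measurableT Iint) rho_gt0 => x /(_ I) fx rx.
rewrite ltNge leye_eq; apply/negP => /eqP Hx; move: fx.
by rewrite Hx poweRyr ?gt_eqF// gt0_mulye ?lte_fin.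
Qed.

End YoungKernel.

(** * Complex-valued integrals *)

Section ComplexIntegrals.
Local Open Scope complex_scope.
Context {R : realType}.
Local Notation leb := (@lebesgue_measure R).
Local Notation normc := (@Normc.normc R).
Local Notation Re := complex.Re.
Local Notation Im := complex.Im.

Lemma normcE (z : R[i]) : normc z = Num.sqrt (Re z ^+ 2 + Im z ^+ 2).
Proof. by case: z. Qed.

Lemma normc_ge0 (z : R[i]) : 0 <= normc z.
Proof. by rewrite normcE sqrtr_ge0. Qed.

Lemma normc_cexpi (t : R) : normc (cexpi t) = 1.
Proof. by rewrite normcE/= cos2Dsin2 sqrtr1. Qed.

Lemma normc_real (x : R) : normc x%:C = `|x|.
Proof. by rewrite normcE/= expr0n addr0 sqrtr_sqr. Qed.

Lemma normRe_le (z : R[i]) : `|Re z| <= normc z.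
Proof. by rewrite normcE -sqrtr_sqr ler_wsqrtr// lerDl sqr_ge0. Qed.

Lemma normIm_le (z : R[i]) : `|Im z| <= normc z.
Proof. by rewrite normcE -sqrtr_sqr ler_wsqrtr// lerDr sqr_ge0. Qed.

Lemma dot_le_normc (z t : R[i]) : Re z * Re t + Im z * Im t <= normc z * normc t.
Proof.
rewrite !normcE -sqrtrM ?addr_ge0 ?sqr_ge0//.
apply: le_trans (ler_norm _) _; rewrite -sqrtr_sqr ler_wsqrtr//.
case: z t => [a b] [c d] /=.
rewrite -subr_ge0 (_ : _ - _ = (a * d - b * c) ^+ 2) ?sqr_ge0//; ring.
Qed.

(** [cmeasurable] for functions on an arbitrary measurable space: joint
measurability in two and three real variables is needed. *)
Definition cmeas d (X : measurableType d) (F : X -> R[i]) : Prop :=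
  measurable_fun setT (fun x => Re (F x)) /\ measurable_fun setT (fun x => Im (F x)).

Lemma cmeas_mul d (X : measurableType d) (F G : X -> R[i]) :
  cmeas F -> cmeas G -> cmeas (fun x => F x * G x).
Proof.
move=> [F1 F2] [G1 G2]; split.
- rewrite (_ : (fun x => _) = fun x => Re (F x) * Re (G x) - Im (F x) * Im (G x)).
    by meas.
  by apply/funext => x; case: (F x) => ? ?; case: (G x).
- rewrite (_ : (fun x => _) = fun x => Re (F x) * Im (G x) + Im (F x) * Re (G x)).
    by meas.
  by apply/funext => x; case: (F x) => ? ?; case: (G x).
Qed.

Lemma cmeas_comp d d' (X : measurableType d) (Y : measurableType d')
  (F : Y -> R[i]) (f : X -> Y) :
  cmeas F -> measurable_fun setT f -> cmeas (fun x => F (f x)).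
Proof.
by move=> [F1 F2] mf; split; [exact: (measurableT_comp F1)|exact: (measurableT_comp F2)].
Qed.

Lemma cmeas_real d (X : measurableType d) (f : X -> R) :
  measurable_fun setT f -> cmeas (fun x => (f x)%:C).
Proof. by move=> mf; split => //=; exact: measurable_cst. Qed.

Lemma cmeas_cexpi d (X : measurableType d) (f : X -> R) :
  measurable_fun setT f -> cmeas (fun x => cexpi (f x)).
Proof.
move=> mf; split => /=.
- apply: (measurableT_comp _ mf); apply: continuous_measurable_fun.
  exact: continuous_cos.
- apply: (measurableT_comp _ mf); apply: continuous_measurable_fun.
  exact: continuous_sin.
Qed.

Lemma measurable_normc d (X : measurableType d) (F : X -> R[i]) :
  cmeas F -> measurable_fun setT (fun x => normc (F x)).
Proof.
move=> [F1 F2]; rewrite (_ : (fun x => _) = fun x => (Re (F x) ^+ 2 + Im (F x) ^+ 2) `^ 2^-1).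
  by meas.
by apply/funext => x; rewrite powR12_sqrt ?addr_ge0 ?sqr_ge0// normcE.
Qed.

(** Tonelli applies to the positive and negative parts separately, and the real
integral is a measurable function of their difference in the extended reals. *)
Lemma measurable_Rintegral_param d (X : measurableType d)
    (f : X * measurableTypeR R -> R) : measurable_fun setT f ->
  measurable_fun setT (fun x => \int[leb]_y f (x, y)).
Proof.
move=> mf; apply: (measurableT_comp (fine_measurable measurableT)).
have mEf : measurable_fun setT (EFin \o f) by exact: measurable_EFin.
pose p := fubini_F leb ((EFin \o f)^\+)%E; pose n := fubini_F leb ((EFin \o f)^\-)%E.
have -> : (fun x => \int[leb]_y (f (x, y))%:E)%E = (p \- n)%E.
  apply/funext => x; rewrite integralE /p /n /fubini_F /=; congr (_ - _)%E.
  - by apply: eq_integral => y _; rewrite !funeposE.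
  - by apply: eq_integral => y _; rewrite !funenegE.
apply: emeasurable_funB; apply: measurable_fun_fubini_tonelli_F => //.
- exact: measurable_funepos.
- exact: measurable_funeneg.
Qed.

Lemma cmeas_cintegral d (X : measurableType d)
    (F : X * measurableTypeR R -> R[i]) : cmeas F ->
  cmeas (fun x => cintegral (fun y => F (x, y))).
Proof.
move=> [F1 F2]; split => /=.
- exact: (measurable_Rintegral_param F1).
- exact: (measurable_Rintegral_param F2).
Qed.

Lemma cintegrable_normc (F : R -> R[i]) : cmeasurable F ->
  (\int[leb]_x (normc (F x))%:E < +oo)%E -> cintegrable F.
Proof.
move=> mF fin; have mN : measurable_fun setT (fun x => normc (F x)).
  exact: (measurable_normc mF).
have [F1 F2] := mF.
by split; apply/integrableP; (split; first exact: measurable_EFin);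
  apply: le_lt_trans fin; apply: ge0_le_integral => //;
  do ?[by move=> x _; rewrite lee_fin normc_ge0|exact: measurable_EFin
   |by apply: measurable_EFin; meas|
   by move=> x _; rewrite lee_fin ?normRe_le ?normIm_le].
Qed.

(** With z = u + iv the integral of F, |z|^2 is the integral of u Re F + v Im F,
which is at most |z| |F| pointwise by Cauchy-Schwarz. *)
Lemma normc_cintegral (F : R -> R[i]) : cmeasurable F ->
  ((normc (cintegral F))%:E <= \int[leb]_x (normc (F x))%:E)%E.
Proof.
move=> mF; have mN : measurable_fun setT (fun x => normc (F x)).
  exact: (measurable_normc mF).
have [fin|] := ltP (\int[leb]_x (normc (F x))%:E)%E +oo%E; last first.
  by rewrite leye_eq => /eqP ->; rewrite leey.
have [I1 I2] := cintegrable_normc mF fin.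
have [z0|z0] := eqVneq (normc (cintegral F)) 0.
  by rewrite z0; apply: integral_ge0 => x _; rewrite lee_fin normc_ge0.
have zp : 0 < normc (cintegral F) by rewrite lt_neqAle eq_sym z0 normc_ge0.
rewrite -(@lee_pmul2l _ (normc (cintegral F))%:E) ?lte_fin//.
rewrite -ge0_integralZl//; last 3 first.
- exact: measurable_EFin.
- by move=> x _; rewrite lee_fin normc_ge0.
- by rewrite lee_fin normc_ge0.
set u := Re (cintegral F); set v := Im (cintegral F).
have -> : ((normc (cintegral F))%:E * (normc (cintegral F))%:E =
   \int[leb]_x (u%:E * (Re (F x))%:E + v%:E * (Im (F x))%:E))%E.
  rewrite integralD//; [|exact: integrableZl|exact: integrableZl].
  rewrite !integralZl//.
  have -> : (\int[leb]_x (Re (F x))%:E = u%:E)%E.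
    by rewrite /u /= /Rintegral fineK//; exact: integrable_fin_num.
  have -> : (\int[leb]_x (Im (F x))%:E = v%:E)%E.
    by rewrite /v /= /Rintegral fineK//; exact: integrable_fin_num.
  rewrite -!EFinM -EFinD; congr EFin.
  by rewrite -expr2 normcE sqr_sqrtr ?addr_ge0 ?sqr_ge0// !expr2.
apply: le_integral => //.
- by apply: integrableD => //; exact: integrableZl.
- apply: (@integrableZl _ _ _ leb setT measurableT _ (fun x => (normc (F x))%:E)).
  apply/integrableP; split; first exact: measurable_EFin.
  by under eq_integral do rewrite gee0_abs ?lee_fin ?normc_ge0//.
- by move=> x _; rewrite lee_fin dot_le_normc.
Qed.

End ComplexIntegrals.

(** * The quadratic-phase Dunkl convolution *)

Section DunklConvolution.
Local Open Scope complex_scope.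
Context {R : realType}.
Variables (mu a d : R).
Local Notation leb := (@lebesgue_measure R).
Local Notation T := (measurableTypeR R).
Local Notation normc := (@Normc.normc R).
Local Notation wt := (@weight R mu).
Local Notation maj := (@majorant R mu).
Local Notation kint := (kernel_int leb wt maj).
Local Notation wnorm := (wnorm leb wt).

Lemma leb_setT_gt0 : (0 < leb [set: R])%E.
Proof.
rewrite -set_itvE lebesgue_measure_itv/=; exact: ltry.
Qed.

Lemma weight_gt0_ae : \forall x \ae leb, 0 < wt x.
Proof.
exists [set 0]; split => //; first exact: lebesgue_measure_set1.
move=> x /= /negP; rewrite -leNgt => wx; apply/eqP; apply: contraTT wx => x0.
by rewrite -ltNge /weight powR_gt0// normr_gt0.
Qed.

Lemma dunkl_normE p (f : R -> R[i]) :
  dunkl_norm mu p f = wnorm p (EFin \o (fun v => normc (f v))).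
Proof.
by case: p => [p| |]//=; congr (_ `^ _)%E; apply: eq_integral => v _; rewrite EFinM.
Qed.

Lemma dunkl_norm_ge0 p (f : R -> R[i]) : (0 <= dunkl_norm mu p f)%E.
Proof.
rewrite dunkl_normE; apply: (@wnorm_ge0 _ T R leb wt leb_setT_gt0) => v.
by rewrite lee_fin normc_ge0.
Qed.

(** The constant 4 is the mass of the majorant, in whichever of its variables. *)
Lemma dunkl_young (p q r : \bar R) (F G : R -> R) :
  (1 <= p)%E -> (1 <= q)%E -> (1 <= r)%E -> (p^-1 + q^-1 = r^-1 + 1)%E ->
  measurable_fun setT F -> (forall x, 0 <= F x) ->
  measurable_fun setT G -> (forall x, 0 <= G x) ->
  (wnorm p (EFin \o F) < +oo)%E -> (wnorm q (EFin \o G) < +oo)%E ->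
  (wnorm r (kint (fun z => (G z.1 * F z.2)%R)) <=
   4%:E * wnorm p (EFin \o F) * wnorm q (EFin \o G))%E.
Proof.
apply: (@kernel_young _ T R leb wt maj 4) => //.
- exact: weight_ge0.
- exact: measurable_weight.
- exact: majorant_ge0.
- by apply: measurable_majorant; meas.
- move=> v k; under eq_integral do rewrite majorantC majorantCr.
  exact: majorant_mass.
- move=> w k; under eq_integral do rewrite majorantCr.
  exact: majorant_mass.
- exact: majorant_mass.
- exact: leb_setT_gt0.
Qed.

Lemma measurable_W_kernel d' (X : measurableType d') (f g h : X -> R) :
  measurable_fun setT f -> measurable_fun setT g -> measurable_fun setT h ->
  measurable_fun setT (fun x => W_kernel mu (f x) (g x) (h x)).
Proof.
move=> mf mg mh; apply: measurable_mul; last first.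
  by apply: measurable_K_kernel; meas.
by rewrite /sigma; meas.
Qed.

Lemma normc_translation_integrand (f : R -> R[i]) w v k :
  normc (translation_integrand mu a d f w (- v) k) <=
  normc (f k) * (maj w v k * wt k).
Proof.
rewrite /translation_integrand /QW_kernel !Normc.normcM !normc_cexpi !normc_real.
rewrite !mulr1 (ger0_norm (weight_ge0 _ _)) -mulrA.
apply: ler_wpM2l; first exact: normc_ge0.
apply: ler_wpM2r; first exact: weight_ge0.
by rewrite -(majorantN _ w v); exact: W_kernel_le.
Qed.


Lemma cmeas_translation_integrand (f : R -> R[i]) : cmeasurable f ->
  cmeas (fun x : T * T * T => translation_integrand mu a d f x.1.1 (- x.1.2) x.2).
Proof.
move=> mf; rewrite /translation_integrand /QW_kernel.
apply: cmeas_mul; last by apply: cmeas_real; apply: (measurableT_comp (measurable_weight mu)); meas.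
apply: cmeas_mul; last by apply: cmeas_cexpi; meas.
apply: cmeas_mul; first by apply: (@cmeas_comp _ _ _ _ T f); meas.
apply: cmeas_mul; first by apply: cmeas_real; apply: measurable_W_kernel; meas.
by apply: cmeas_cexpi; meas.
Qed.

Lemma cmeas_translation (f : R -> R[i]) : cmeasurable f ->
  cmeas (fun x : T * T => translation mu a d f x.1 (- x.2)).
Proof.
move=> mf; exact: (cmeas_cintegral (cmeas_translation_integrand mf)).
Qed.

Lemma cmeas_convolution_integrand (f g : R -> R[i]) :
  cmeasurable f -> cmeasurable g ->
  cmeas (fun x : T * T => convolution_integrand mu a d f g x.1 x.2).
Proof.
move=> mf mg; rewrite /convolution_integrand.
apply: cmeas_mul; last by apply: cmeas_real; apply: (measurableT_comp (measurable_weight mu)); meas.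
apply: cmeas_mul; last by apply: cmeas_cexpi; meas.
apply: cmeas_mul; first exact: cmeas_translation.
by apply: (@cmeas_comp _ _ _ _ T g); meas.
Qed.

Lemma cmeasurable_convolution (f g : R -> R[i]) :
  cmeasurable f -> cmeasurable g -> cmeasurable (convolution mu a d f g).
Proof.
move=> mf mg; exact: (cmeas_cintegral (cmeas_convolution_integrand mf mg)).
Qed.

Lemma cmeasurable_translation_integrand (f : R -> R[i]) w v : cmeasurable f ->
  cmeasurable (translation_integrand mu a d f w (- v)).
Proof.
move=> mf.
apply: (@cmeas_comp _ _ _ T _ _ (fun k : T => ((w, v), k)) (cmeas_translation_integrand mf)).
by meas.
Qed.

Lemma cmeasurable_convolution_integrand (f g : R -> R[i]) w :
  cmeasurable f -> cmeasurable g ->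
  cmeasurable (convolution_integrand mu a d f g w).
Proof.
move=> mf mg.
apply: (@cmeas_comp _ _ _ T _ _ (fun v : T => (w, v)) (cmeas_convolution_integrand mf mg)).
by meas.
Qed.

Lemma integral_translation_le (f : R -> R[i]) w v : cmeasurable f ->
  (\int[leb]_k (normc (translation_integrand mu a d f w (- v) k))%:E <=
   \int[leb]_k (normc (f k) * (maj w v k * wt k))%:E)%E.
Proof.
move=> mf; have mN := measurable_normc mf; have mw := measurable_weight mu.
apply: ge0_le_integral => //.
- by move=> k _; rewrite lee_fin normc_ge0.
- apply: measurable_EFin; apply: measurable_normc.
  exact: cmeasurable_translation_integrand.
- apply: measurable_EFin; apply: measurable_mul => //.
  by apply: measurable_mul => //; apply: measurable_majorant; meas.
- by move=> k _; rewrite lee_fin normc_translation_integrand.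
Qed.

Lemma kint_iter (F G : R -> R) w :
  measurable_fun setT F -> (forall x, 0 <= F x) ->
  measurable_fun setT G -> (forall x, 0 <= G x) ->
  kint (fun z => (G z.1 * F z.2)%R) w =
  (\int[leb]_v ((G v * wt v)%:E * \int[leb]_k (F k * (maj w v k * wt k))%:E))%E.
Proof.
apply: (@kernel_int_iter _ T R leb wt maj) => //.
- exact: weight_ge0.
- exact: measurable_weight.
- exact: majorant_ge0.
- by apply: measurable_majorant; meas.
Qed.

(** The phases have modulus 1, so in absolute value the convolution at w is at most
the double integral of |g(v)| |f(k)| against the majorant. *)
Lemma integral_convolution_le (f g : R -> R[i]) w :
  cmeasurable f -> cmeasurable g ->
  (\int[leb]_v (normc (convolution_integrand mu a d f g w v))%:E <=
   kint (fun z => (normc (g z.1) * normc (f z.2))%R) w)%E.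
Proof.
move=> mf mg; have mN := measurable_normc mf; have mw := measurable_weight mu.
have mG := measurable_normc mg.
rewrite (@kint_iter (fun x => normc (f x)) (fun x => normc (g x)))//;
  [|by move=> x; exact: normc_ge0|by move=> x; exact: normc_ge0].
have mh : measurable_fun setT (fun x : T * T =>
    (normc (f x.2) * (maj w x.1 x.2 * wt x.2))%:E).
  apply: measurable_EFin; apply: measurable_mul.
    by apply: measurable_normc; apply: (@cmeas_comp _ _ _ _ T f); meas.
  apply: measurable_mul; first by apply: measurable_majorant; meas.
  by apply: (measurableT_comp mw); meas.
have h0 v k : (0 <= (normc (f k) * (maj w v k * wt k))%:E)%E.
  rewrite lee_fin mulr_ge0//; first exact: normc_ge0.
  by rewrite mulr_ge0//; [exact: majorant_ge0|exact: weight_ge0].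
apply: ge0_le_integral => //.
- by move=> v _; rewrite lee_fin normc_ge0.
- apply: measurable_EFin; apply: measurable_normc.
  exact: cmeasurable_convolution_integrand.
- apply: measurable_emul; first by apply: measurable_EFin; exact: measurable_mul.
  exact: (@measurable_fun_fubini_tonelli_F _ _ T T R leb _ mh).
move=> v _; rewrite /convolution_integrand !Normc.normcM normc_cexpi normc_real mulr1.
rewrite (ger0_norm (weight_ge0 _ _)) -mulrA mulrC EFinM.
apply: lee_wpmul2l; first by rewrite lee_fin mulr_ge0 ?normc_ge0 ?weight_ge0.
apply: le_trans (integral_translation_le w v mf).
by apply: normc_cintegral; exact: cmeasurable_translation_integrand.
Qed.

Lemma normc_convolution_le (f g : R -> R[i]) w :
  cmeasurable f -> cmeasurable g ->
  ((normc (convolution mu a d f g w))%:E <=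
   kint (fun z => (normc (g z.1) * normc (f z.2))%R) w)%E.
Proof.
move=> mf mg; apply: le_trans (integral_convolution_le w mf mg).
by apply: normc_cintegral; exact: cmeasurable_convolution_integrand.
Qed.

Lemma measurable_kint (F G : R -> R) :
  measurable_fun setT F -> (forall x, 0 <= F x) ->
  measurable_fun setT G -> (forall x, 0 <= G x) ->
  measurable_fun setT (kint (fun z => (G z.1 * F z.2)%R)).
Proof.
move=> mF F0 mG G0.
apply: (@measurable_kernel_int _ T R leb wt maj) => //.
- exact: weight_ge0.
- exact: measurable_weight.
- exact: majorant_ge0.
- by apply: measurable_majorant; meas.
- apply: measurable_mul; first by apply: (measurableT_comp mG); meas.
  by apply: (measurableT_comp mF); meas.
- by move=> z; rewrite mulr_ge0.
Qed.

Lemma kint_ge0 (F G : R -> R) w : (forall x, 0 <= F x) -> (forall x, 0 <= G x) ->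
  (0 <= kint (fun z => (G z.1 * F z.2)%R) w)%E.
Proof.
move=> F0 G0; apply: kernel_int_ge0 => [x|x y z|z].
- exact: weight_ge0.
- exact: majorant_ge0.
- by rewrite mulr_ge0.
Qed.

Lemma mul_lty (c : R) (x y : \bar R) : (0 <= x)%E -> (0 <= y)%E ->
  (x < +oo)%E -> (y < +oo)%E -> (c%:E * x * y < +oo)%E.
Proof. by case: x y => [x| |]// [y| |]// _ _ _ _; rewrite -!EFinM ltry. Qed.

Lemma kint_lty_ae (p q r : \bar R) (F G : R -> R) :
  (1 <= p)%E -> (1 <= q)%E -> (1 <= r)%E -> (p^-1 + q^-1 = r^-1 + 1)%E ->
  measurable_fun setT F -> (forall x, 0 <= F x) ->
  measurable_fun setT G -> (forall x, 0 <= G x) ->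
  (wnorm p (EFin \o F) < +oo)%E -> (wnorm q (EFin \o G) < +oo)%E ->
  \forall w \ae leb, (kint (fun z => (G z.1 * F z.2)%R) w < +oo)%E.
Proof.
move=> p1 q1 r1 pqr mF F0 mG G0 nF nG.
apply: (@wnorm_lty_ae _ T R leb wt (weight_ge0 mu) (measurable_weight mu) r) => //.
- exact: measurable_kint.
- by move=> w; exact: kint_ge0.
- exact: weight_gt0_ae.
apply: le_lt_trans (dunkl_young p1 q1 r1 pqr mF F0 mG G0 nF nG) _.
by apply: mul_lty => //; apply: wnorm_ge0 => //; (try exact: leb_setT_gt0);
  move=> x; rewrite lee_fin.
Qed.

(** A function that is positive off 0 and integrable for |v|^(2 mu + 1) dv, since
the weight cancels and leaves a Gaussian. *)
Definition probe (v : R) : R := expR (- v ^+ 2) / wt v.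

Lemma probe_ge0 v : 0 <= probe v.
Proof. by rewrite divr_ge0 ?expR_ge0 ?weight_ge0. Qed.

Lemma measurable_probe : measurable_fun setT probe.
Proof. by have mw := measurable_weight mu; rewrite /probe; meas. Qed.

Lemma wnorm_probe : (wnorm 1%:E (EFin \o probe) < +oo)%E.
Proof.
rewrite /wnorm /= poweR_lty//; apply: le_lt_trans (ltry (Num.sqrt (pi : R))).
rewrite -integralT_gauss; have mw := measurable_weight mu; have mp := measurable_probe.
apply: ge0_le_integral => //.
- by move=> v _; rewrite mule_ge0 ?lee_fin ?powR_ge0 ?weight_ge0.
- by meas.
- by apply: measurable_EFin; exact: measurable_gauss_fun.
move=> v _; rewrite -EFinM lee_fin powRr1 ?probe_ge0// /probe.
have [->|w0] := eqVneq (wt v) 0; first by rewrite mulr0 gauss_fun_ge0.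
by rewrite divfK.
Qed.

(** Where g vanishes, finiteness of the convolution bound says nothing about the
inner integral. Hence Young's inequality is applied to f and the positive
function [probe] instead, with exponents p, 1, p. *)
Lemma translation_defined_ae (p : \bar R) (f : R -> R[i]) : (1 <= p)%E ->
  dunkl_Lp mu p f -> \forall w \ae leb, \forall v \ae leb,
    cintegrable (translation_integrand mu a d f w (- v)).
Proof.
move=> p1 [mf nf]; have mN := measurable_normc mf.
have N0 v : 0 <= normc (f v) by exact: normc_ge0.
rewrite dunkl_normE in nf.
have e : (p^-1 + 1^-1 = p^-1 + 1 :> \bar R)%E by rewrite inve1.
have := kint_lty_ae p1 (lexx _) p1 e mN N0 measurable_probe probe_ge0 nf wnorm_probe.
apply: filterS => w; move=> kfin.
have kE := @kint_iter _ _ w mN N0 measurable_probe probe_ge0.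
pose P v := (\int[leb]_k (normc (f k) * (maj w v k * wt k))%:E)%E.
have P0 v : (0 <= P v)%E.
  apply: integral_ge0 => k _; rewrite lee_fin mulr_ge0//.
  by rewrite mulr_ge0//; [exact: majorant_ge0|exact: weight_ge0].
have mh : measurable_fun setT (fun x : T * T =>
    (normc (f x.2) * (maj w x.1 x.2 * wt x.2))%:E).
  apply: measurable_EFin; apply: measurable_mul.
    by apply: measurable_normc; apply: (@cmeas_comp _ _ _ _ T f); meas.
  apply: measurable_mul; first by apply: measurable_majorant; meas.
  by apply: (measurableT_comp (measurable_weight mu)); meas.
have mP : measurable_fun setT P.
  apply: (@measurable_fun_fubini_tonelli_F _ _ T T R leb _ mh).
  move=> x; rewrite lee_fin mulr_ge0//.
  by rewrite mulr_ge0//; [exact: majorant_ge0|exact: weight_ge0].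
have fin : (\int[leb]_v ((probe v * wt v)%:E * P v) < +oo)%E.
  by rewrite -kE.
have I0 v : (0 <= (probe v * wt v)%:E * P v)%E.
  by rewrite mule_ge0 ?lee_fin// mulr_ge0 ?probe_ge0 ?weight_ge0.
have Pint : leb.-integrable setT (fun v => (probe v * wt v)%:E * P v)%E.
  apply/integrableP; split.
    apply: measurable_emul => //; apply: measurable_EFin; apply: measurable_mul.
      exact: measurable_probe.
    exact: measurable_weight.
  by under eq_integral do rewrite gee0_abs//.
apply: filterS2 (integrable_ae measurableT Pint) weight_gt0_ae => v /(_ I) finv wv.
apply: cintegrable_normc; first exact: cmeasurable_translation_integrand.
apply: le_lt_trans (integral_translation_le w v mf) _.
rewrite -/(P v) ltNge leye_eq; apply/negP => /eqP Pv; move: finv.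
(* probe and weight are positive at v: an infinite inner integral contradicts finv *)
by rewrite Pv gt0_muley// lte_fin /probe divfK ?gt_eqF// expR_gt0.
Qed.

Lemma wnorm_le r (H H' : R -> \bar R) : (1 <= r)%E ->
  measurable_fun setT H -> (forall x, 0 <= H x)%E ->
  measurable_fun setT H' -> (forall x, H x <= H' x)%E ->
  (wnorm r H <= wnorm r H')%E.
Proof.
case: r => [r| |]//= r1 mH H0 mH' HH'; last first.
  by apply: le_ess_sup; exact: nearW.
have r0 : 0 < r by rewrite lee_fin in r1; exact: lt_le_trans r1.
have H0' x : (0 <= H' x)%E by exact: le_trans (H0 x) (HH' x).
have mw := measurable_weight mu.
have I0 (L : R -> \bar R) : (0 <= \int[leb]_x (L x `^ r * (wt x)%:E))%E.
  by apply: integral_ge0 => x _; rewrite mule_ge0 ?poweR_ge0 ?lee_fin ?weight_ge0.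
have mI (L : R -> \bar R) : measurable_fun setT L ->
    measurable_fun setT (fun x => L x `^ r * (wt x)%:E)%E.
  move=> mL; apply: measurable_emul; last by meas.
  exact: (measurableT_comp (measurable_poweR r)).
apply: gt0_ler_poweR; rewrite ?in_itv/= ?I0 ?leey ?invr_ge0 ?(ltW r0)//.
apply: ge0_le_integral => //.
- by move=> x _; rewrite mule_ge0 ?poweR_ge0 ?lee_fin ?weight_ge0.
- exact: mI.
- exact: mI.
- move=> x _; apply: lee_wpmul2r; first by rewrite lee_fin weight_ge0.
  by apply: gt0_ler_poweR; rewrite ?in_itv/= ?H0 ?H0' ?leey ?(ltW r0).
Qed.

Lemma convolution_young (p q r : \bar R) (f g : R -> R[i]) :
  (1 <= p)%E -> (1 <= q)%E -> (1 <= r)%E -> (p^-1 + q^-1 = r^-1 + 1)%E ->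
  dunkl_Lp mu p f -> dunkl_Lp mu q g ->
  [/\ \forall w \ae leb, convolution_defined mu a d f g w,
      dunkl_Lp mu r (convolution mu a d f g)
    & (dunkl_norm mu r (convolution mu a d f g) <=
       4%:E * dunkl_norm mu p f * dunkl_norm mu q g)%E].
Proof.
move=> p1 q1 r1 pqr Lf Lg; have [mf nf] := Lf; have [mg ng] := Lg.
have mF := measurable_normc mf; have mG := measurable_normc mg.
have F0 v : 0 <= normc (f v) by exact: normc_ge0.
have G0 v : 0 <= normc (g v) by exact: normc_ge0.
have mc := cmeasurable_convolution mf mg.
have bound : (dunkl_norm mu r (convolution mu a d f g) <=
     4%:E * dunkl_norm mu p f * dunkl_norm mu q g)%E.
  rewrite dunkl_normE in nf; rewrite dunkl_normE in ng; rewrite !dunkl_normE.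
  apply: le_trans (dunkl_young p1 q1 r1 pqr mF F0 mG G0 nf ng).
  apply: wnorm_le => //.
  - by apply/measurable_EFinP; exact: measurable_normc mc.
  - by move=> x; rewrite lee_fin normc_ge0.
  - exact: (measurable_kint mF F0 mG G0).
  - by move=> w; exact: normc_convolution_le.
split=> //; last first.
  split=> //; apply: le_lt_trans bound _.
  by apply: mul_lty => //; exact: dunkl_norm_ge0.
have fin : \forall w \ae leb,
    (kint (fun z => (normc (g z.1) * normc (f z.2))%R) w < +oo)%E.
  rewrite dunkl_normE in nf; rewrite dunkl_normE in ng.
  exact: (kint_lty_ae p1 q1 r1 pqr mF F0 mG G0 nf ng).
have Tdef := translation_defined_ae p1 Lf.
apply: (@filterS2 T _ _ _ _ _ _ Tdef fin) => w Tw fw; split=> //.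
apply: cintegrable_normc; first exact: cmeasurable_convolution_integrand.
exact: le_lt_trans (integral_convolution_le w mf mg) fw.
Qed.

End DunklConvolution.

Theorem proposition5p3 (R : realType) (a b c d e mu : R)
    (hb : b != 0) (hmu : - 2^-1 < mu) :
  (forall (p q r : \bar R) (f g : R -> R[i]),
     (1 <= p)%E -> (1 <= q)%E -> (1 <= r)%E ->
     (p^-1 + q^-1 = r^-1 + 1)%E ->
     dunkl_Lp mu p f -> dunkl_Lp mu q g ->
     [/\ \forall w \ae (@lebesgue_measure R),
           convolution_defined mu a d f g w,
         dunkl_Lp mu r (convolution mu a d f g)
       & (dunkl_norm mu r (convolution mu a d f g)
            <= 4%:E * dunkl_norm mu p f * dunkl_norm mu q g)%E])
  /\
  (forall f g : R -> R[i],
     dunkl_Lp mu 1%E f -> dunkl_Lp mu 1%E g ->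
     (\forall w \ae (@lebesgue_measure R),
        convolution_defined mu a d f g w) /\
     dunkl_Lp mu 1%E (convolution mu a d f g)).
Proof.
split; first by move=> *; exact: convolution_young.
move=> f g Lf Lg.
have e1 : (1^-1 + 1^-1 = 1^-1 + 1 :> \bar R)%E by rewrite inve1.
by have [] := convolution_young a d (lexx _) (lexx _) (lexx _) e1 Lf Lg.
Qed.
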